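(* Let $X$ be a (real or complex) Banach space of dimension at least $3$. Let $\phi: I_1(X)\to I_1(X)$ be a bijective transformation with the property that $$PQ=0 \Longleftrightarrow \phi(P)\phi(Q)=0$$ for all $P,Q\in I_1(X)$. Then the following hold. (1) If $X$ is real, then there exists an invertible bounded linear operator $A:X\to X$ such that $$\phi(P)=APA^{-1}\qquad (P\in I_1(X)).$$ (2) If $X$ is complex and infinite dimensional, then there exists an invertible bounded linear or conjugate-linear operator $A:X\to X$ such that $$\phi(P)=APA^{-1}\qquad (P\in I_1(X)).$$ (3) If $X$ is complex and finite dimensional with $n=\dim X$, then, identifying $X$ with $\mathbb{C}^n$ and operators on $X$ with $n\times n$ complex matrices, there exist a nonsingular matrix $A\in M_n(\mathbb{C})$ and a ring automorphism $h$ of $\mathbb{C}$ such that $$\phi(P)=A\,h(P)\,A^{-1}\qquad (P\in I_1(\mathbb{C}^n)),$$ where $h(P)$ denotes the matrix obtained from $P$ by applying $h$ to every entry of $P$.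
   Context: For a real or complex Banach space $X$, $B(X)$ denotes the algebra of all bounded linear operators on $X$. An operator $P\in B(X)$ is called an idempotent if $P^2=P$. $I_1(X)$ denotes the set of all rank-one idempotents in $B(X)$. $M_n(\mathbb{C})$ is the algebra of $n\times n$ complex matrices. A ring automorphism of $\mathbb{C}$ is a bijective additive and multiplicative map $\mathbb{C}\to\mathbb{C}$ (no continuity is assumed). *)

(* Defs.v *)
(* MathComp-Analysis, with complex scalars R[i] from mathcomp-real-closed. *)
From HB Require Import structures.
From mathcomp Require Import all_boot all_order all_algebra complex.
From mathcomp Require Import boolp classical_sets functions reals topology.
From mathcomp Require Import normedtype.

Set Implicit Arguments.
Unset Strict Implicit.
Unset Printing Implicit Defensive.

Import Order.TTheory GRing.Theory Num.Theory.
Import numFieldNormedType.Exports.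

Local Open Scope classical_set_scope.
Local Open Scope ring_scope.

Section LinearAlgebra.
Variables (K : fieldType) (V : lmodType K).

Definition lin_indep (n : nat) (e : 'I_n -> V) : Prop :=
  forall c : 'I_n -> K, \sum_(i < n) c i *: e i = 0 -> forall i, c i = 0.

Definition lin_span (n : nat) (e : 'I_n -> V) : set V :=
  [set \sum_(i < n) c i *: e i | c in [set: 'I_n -> K]].

Definition lin_basis (W : set V) (n : nat) (e : 'I_n -> V) : Prop :=
  lin_indep e /\ lin_span e = W.

Definition has_dim (W : set V) (n : nat) : Prop :=
  exists e : 'I_n -> V, lin_basis W e.

(* Infinite-dimensional spaces are included. *)
Definition dim_ge (n : nat) : Prop := exists e : 'I_n -> V, lin_indep e.

Definition infinite_dim : Prop := ~ exists n, has_dim [set: V] n.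

(* The coordinates are unique when e is a basis of V; the default value 0 is
   returned for a vector outside the span of e. *)
Definition coords (n : nat) (e : 'I_n -> V) (x : V) : 'cV[K]_n :=
  xget 0 [set c : 'cV[K]_n | x = \sum_(i < n) c i 0 *: e i].

(* Column j holds the coordinates of T (e j), so that operators act on column
   vectors on the left. *)
Definition op_mx (n : nat) (e : 'I_n -> V) (T : V -> V) : 'M[K]_n :=
  \matrix_(i, j) coords e (T (e j)) i 0.

Lemma coordsE (n : nat) (e : 'I_n -> V) (x : V) :
  lin_basis [set: V] e -> \sum_(i < n) coords e x i 0 *: e i = x.
Proof.
move=> [_ eV]; rewrite /coords; case: xgetP => [c _ /= -> //|/= noc].
have [c _ cx] : lin_span e x by rewrite eV.
case: (noc (\col_i c i)) => /=; rewrite -cx.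
by apply: eq_bigr => i _; rewrite mxE.
Qed.

Lemma coords_op_mx (n : nat) (e : 'I_n -> V) (T : V -> V) (x : V) :
  lin_basis [set: V] e -> linear T ->
  coords e (T x) = op_mx e T *m coords e x.
Proof.
move=> eV linT.
pose f := HB.pack_for {linear V -> V} T (GRing.isLinear.Build _ _ _ _ T linT).
have Tx : T x = \sum_i (op_mx e T *m coords e x) i 0 *: e i.
  rewrite -{1}(coordsE x eV) -[T]/(f : V -> V) linear_sum.
  under eq_bigr => j _ do rewrite linearZ /= -(coordsE (T (e j)) eV) scaler_sumr.
  rewrite exchange_big; apply: eq_bigr => i _.
  rewrite mxE scaler_suml; apply: eq_bigr => j _.
  by rewrite scalerA mulrC mxE.
apply/colP => i; apply/eqP; rewrite -subr_eq0; apply/eqP.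
apply: (eV.1 (fun i => coords e (T x) i 0 - (op_mx e T *m coords e x) i 0)).
under eq_bigr => j _ do rewrite scalerBl.
by rewrite sumrB -Tx coordsE // subrr.
Qed.

End LinearAlgebra.

Section Operators.
Variables (K : numFieldType) (X : normedModType K).

(* s is the scaling convention: *:%R for linear operators, and
   conjc \; *:%R for conjugate-linear ones. *)
Definition bounded_op (s : K -> X -> X) (A : X -> X) : Prop :=
  linear_for s A /\ exists M : K, forall x, `|A x| <= M * `|x|.

(* A and B are mutually inverse bounded operators, i.e. A is invertible and
   B = A^-1. *)
Definition bounded_inverse (s : K -> X -> X) (A B : X -> X) : Prop :=
  [/\ bounded_op s A, bounded_op s B, cancel A B & cancel B A].

Definition rank_one_idempotent : set (X -> X) :=
  [set P | [/\ bounded_op *:%R P, P \o P = P & has_dim (range P) 1]].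

Definition preserves_zero_products
    (phi : rank_one_idempotent -> rank_one_idempotent) : Prop :=
  forall P Q : rank_one_idempotent,
    \val P \o \val Q = cst 0 <-> \val (phi P) \o \val (phi Q) = cst 0.

End Operators.

Arguments rank_one_idempotent {K} X.
Arguments dim_ge {K} V n.
Arguments infinite_dim {K} V.

(* Main.v *)
Require Import Defs.
From HB Require Import structures.
From mathcomp Require Import all_boot all_order all_algebra complex.
From mathcomp Require Import boolp classical_sets functions reals topology.
From mathcomp Require Import normedtype.
From mathcomp Require Import ring lra.

(** A rank-one idempotent is [x |-> f x *: u] with [f u = 1], and [P Q = 0] says
    that [f_P] vanishes at [u_Q].  As bounded functionals separate points
    (Hahn-Banach), a linear relation [u_R \in <u_P, u_Q>] can be read off from
    zero products, so [phi] induces a collineation of the projective space of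
    [X].  By the fundamental theorem of projective geometry it comes from an
    [h]-semilinear bijection [A], and [phi P = A P A^-1] because both sides are
    idempotents with the same range and kernel.  Moreover [f |-> h o f o A^-1]
    permutes the bounded functionals.  Over the reals [h] is the identity; over
    the complex numbers a gliding-hump argument in infinite dimension shows that
    [h] is bounded near [0], hence the identity or the conjugation.  In both
    cases uniform boundedness makes [A] and [A^-1] bounded. *)

Set Implicit Arguments.
Unset Strict Implicit.
Unset Printing Implicit Defensive.

Import Order.TTheory GRing.Theory Num.Theory.
Import numFieldNormedType.Exports.

Local Open Scope classical_set_scope.
Local Open Scope ring_scope.
Local Open Scope complex_scope.

(** * Collineations are semilinear *)

Section Collineation.
(** [alpha] picks a vector on the image of each line. As it matches [ker f0] with [ker g0], the
    affine charts [f0 = 1] and [g0 = 1] correspond, and normalising in them removes the arbitrary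
    scalars. [dimH] makes [ker f0] at least two-dimensional. *)
Variables (K : fieldType) (X : lmodType K) (alpha : X -> X) (f0 g0 : {scalar X}).
Variable e : X.
Hypothesis alpha0 : forall v : X, v != 0 -> alpha v != 0.
Hypothesis alpha_line : forall u v w : X, u != 0 -> v != 0 -> w != 0 ->
  (exists a b, w = a *: u + b *: v) <->
  (exists a b, alpha w = a *: alpha u + b *: alpha v).
Hypothesis alpha_surj : forall u : X, u != 0 ->
  exists (v : X) c, v != 0 /\ u = c *: alpha v.
Hypothesis alpha_ker : forall v : X, v != 0 -> (f0 v == 0) = (g0 (alpha v) == 0).
Hypothesis f0e : f0 e = 1.
Hypothesis dimH : forall x, exists w, f0 w = 0 /\ forall c, w <> c *: x.

Let f0_neq0 x : f0 x != 0 -> x != 0.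
Proof. by apply: contraNneq => ->; rewrite linear0. Qed.

Let e_neq0 : e != 0.
Proof. by apply: f0_neq0; rewrite f0e oner_neq0. Qed.

Let indep_neq0 (w x : X) : (forall c, w <> c *: x) -> w != 0.
Proof. by move=> wx; apply/eqP => w0; apply: (wx 0); rewrite scale0r. Qed.

Lemma alpha_scale u w c : u != 0 -> w != 0 -> w = c *: u ->
  exists d, alpha w = d *: alpha u.
Proof.
move=> u0 w0 wu; have [+ _] := alpha_line u0 u0 w0.
case; first by exists c, 0; rewrite scale0r addr0.
by move=> a [b ->]; exists (a + b); rewrite scalerDl.
Qed.

Lemma alpha_unscale u w d : u != 0 -> w != 0 -> alpha w = d *: alpha u ->
  exists c, w = c *: u.
Proof.
move=> u0 w0 wu; have [_] := alpha_line u0 u0 w0.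
case; first by exists d, 0; rewrite scale0r addr0.
by move=> a [b ->]; exists (a + b); rewrite scalerDl.
Qed.

(** The representative of the image point in the chart [g0 = 1], meaningful when [g0 (alpha x)] is
    nonzero. *)
Definition normal_rep (x : X) := (g0 (alpha x))^-1 *: alpha x.

(* The action of [alpha] on the affine hyperplane [e + ker f0], read in the
   direction space [ker f0]. *)
Definition direction_map (v : X) := normal_rep (e + v) - normal_rep e.

Local Notation N := normal_rep.
Local Notation A := direction_map.

Let f0ev v : f0 v = 0 -> f0 (e + v) != 0.
Proof. by move=> v0; rewrite linearD /= v0 addr0 f0e oner_neq0. Qed.

Let g0ev v : f0 v = 0 -> g0 (alpha (e + v)) != 0.
Proof.
by move=> v0; rewrite -alpha_ker ?f0ev //; apply: f0_neq0; exact: f0ev.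
Qed.

Let A0 : A 0 = 0.
Proof. by rewrite /A addr0 subrr. Qed.

Let g0N v : f0 v = 0 -> g0 (N (e + v)) = 1.
Proof. by move=> v0; rewrite /N linearZ /= mulVf // g0ev. Qed.

Let g0Ne : g0 (N e) = 1.
Proof. by rewrite -[e]addr0 g0N // linear0. Qed.

Let g0A v : f0 v = 0 -> g0 (A v) = 0.
Proof. by move=> v0; rewrite /A linearB /= g0N // g0Ne subrr. Qed.

(** The point [e + (v + w)] is on the line joining [e + v] to the point at infinity [w]. Since [g0]
    vanishes at [alpha w], normalisation forces coefficient one on [N (e + v)]. *)
Lemma direction_add_scale v w : f0 v = 0 -> f0 w = 0 -> w != 0 ->
  exists s, A (v + w) = A v + s *: alpha w.
Proof.
move=> v0 w0 wn0.
have vw0 : f0 (v + w) = 0 by rewrite linearD /= v0 w0 addr0.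
have [+ _] := alpha_line (f0_neq0 (f0ev v0)) wn0 (f0_neq0 (f0ev vw0)).
case; first by exists 1, 1; rewrite !scale1r addrA.
move=> a [b E]; have := congr1 g0 E.
have /eqP gw : g0 (alpha w) == 0 by rewrite -alpha_ker // w0.
rewrite linearD /= !linearZ /= gw mulr0 addr0 => G.
have a0 : a != 0.
  by apply: contra_neq (g0ev vw0) => a0; rewrite G a0 mul0r.
exists ((g0 (alpha (e + (v + w))))^-1 * b).
rewrite /A /N addrAC; congr (_ - _).
rewrite [X in _ *: X = _]E scalerDr !scalerA G.
by congr (_ *: _ + _); rewrite invfM mulrAC mulVf // mul1r.
Qed.

(** Starting from the vector [0] in the preceding lemma makes [A v] a multiple of [alpha v]. If it
    were zero, [e + v] would be proportional to [e], and applying [f0] would give [v = 0]. *)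
Lemma direction_alpha v : f0 v = 0 -> v != 0 ->
  exists2 c, c != 0 & A v = c *: alpha v.
Proof.
move=> v0 vn0; have [c] := direction_add_scale (linear0 f0) v0 vn0.
rewrite add0r A0 add0r => Av; exists c => //.
apply: contra_neq vn0 => c0; move: Av; rewrite c0 scale0r => /eqP.
rewrite subr_eq0 => /eqP; rewrite /N => E.
have [|d] := @alpha_unscale e (e + v) (g0 (alpha (e + v)) / g0 (alpha e))
  e_neq0 (f0_neq0 (f0ev v0)).
  by rewrite -scalerA -E scalerA mulfV ?scale1r // g0ev.
move=> D; have := congr1 f0 D.
rewrite linearD linearZ /= f0e v0 addr0 mulr1 => d1.
by move: D; rewrite -d1 scale1r => /eqP; rewrite -subr_eq0 addrAC subrr add0r => /eqP.
Qed.

Let A_neq0 v : f0 v = 0 -> v != 0 -> A v != 0.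
Proof.
move=> v0 vn0; have [c c0 ->] := direction_alpha v0 vn0.
by rewrite scaler_eq0 negb_or c0 alpha0.
Qed.

Let A_dep v w s : f0 v = 0 -> f0 w = 0 -> v != 0 -> A w = s *: A v ->
  exists t, w = t *: v.
Proof.
move=> v0 w0 vn0 E; have [->|wn0] := eqVneq w 0; first by exists 0; rewrite scale0r.
have [c c0 Ec] := direction_alpha v0 vn0; have [d d0 Ed] := direction_alpha w0 wn0.
apply: (@alpha_unscale v w (d^-1 * s * c)) => //.
by rewrite -scalerA -Ec -scalerA -E Ed scalerA mulVf // scale1r.
Qed.

Let A_add_scale v w : f0 v = 0 -> f0 w = 0 -> w != 0 ->
  exists s, A (v + w) = A v + s *: A w.
Proof.
move=> v0 w0 wn0; have [s ->] := direction_add_scale v0 w0 wn0.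
have [c c0 ->] := direction_alpha w0 wn0; exists (s / c).
by rewrite scalerA divfK.
Qed.

Let A_scale v t : f0 v = 0 -> v != 0 -> exists s, A (t *: v) = s *: A v.
Proof.
move=> v0 vn0; have [->|t0] := eqVneq t 0.
  by exists 0; rewrite !scale0r A0.
have tv0 : f0 (t *: v) = 0 by rewrite linearZ /= v0 mulr0.
have tvn0 : t *: v != 0 by rewrite scaler_eq0 negb_or t0.
have [c c0 ->] := direction_alpha tv0 tvn0.
have [d d0 ->] := direction_alpha v0 vn0.
have [k ->] := alpha_scale vn0 tvn0 erefl.
by exists (c * k / d); rewrite !scalerA divfK.
Qed.

Let coef_eq (a b : X) s t s' t' : (forall c, b <> c *: a) -> a != 0 ->
  s *: a + t *: b = s' *: a + t' *: b -> s = s' /\ t = t'.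
Proof.
move=> ab a0 /eqP; rewrite -subr_eq0 opprD addrACA -!scalerBl.
have [->|tt] := eqVneq t t'.
  by rewrite subrr scale0r addr0 scaler_eq0 (negbTE a0) orbF subr_eq0 => /eqP.
rewrite addr_eq0 => /eqP E; exfalso; rewrite -subr_eq0 in tt.
apply: (ab (- (t - t')^-1 * (s - s'))).
by rewrite -scalerA E scaleNr scalerN opprK scalerA mulVf // scale1r.
Qed.

Let A_indep v w : f0 v = 0 -> f0 w = 0 -> v != 0 -> (forall c, w <> c *: v) ->
  forall c, A w <> c *: A v.
Proof.
by move=> v0 w0 vn0 vw c E; have [t] := A_dep v0 w0 vn0 E; exact: vw.
Qed.

(** Parallelogram argument: [A (v + w)] is both [A v + s *: A w] and [A w + t *: A v], and the
    independence of [A v] and [A w] forces [s = t = 1]. *)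
Let A_add_indep v w : f0 v = 0 -> f0 w = 0 -> (forall c, w <> c *: v) ->
  A (v + w) = A v + A w.
Proof.
move=> v0 w0 vw; have wn0 := indep_neq0 vw.
have [->|vn0] := eqVneq v 0; first by rewrite !add0r A0 add0r.
have [s E] := A_add_scale v0 w0 wn0; have [t E'] := A_add_scale w0 v0 vn0.
have := @coef_eq (A v) (A w) 1 s t 1 (A_indep v0 w0 vn0 vw) (A_neq0 v0 vn0).
rewrite !scale1r => -[|_ s1]; first by rewrite -E addrC E' addrC.
by rewrite E s1 scale1r.
Qed.

Let f0Z t v : f0 v = 0 -> f0 (t *: v) = 0.
Proof. by move=> v0; rewrite linearZ /= v0 mulr0. Qed.

(** Expanding [A (t *: (v + w))] in two ways and comparing coefficients along [A v] and [A w]. *)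
Let h_indep v w s t s' : f0 v = 0 -> f0 w = 0 -> v != 0 -> (forall c, w <> c *: v) ->
  A (t *: v) = s *: A v -> A (t *: w) = s' *: A w -> s = s'.
Proof.
move=> v0 w0 vn0 vw Ev Ew.
have [t0|t0] := eqVneq t 0.
  move: Ev Ew; rewrite t0 !scale0r A0 => /esym/eqP.
  rewrite scaler_eq0 (negbTE (A_neq0 v0 vn0)) orbF => /eqP -> /esym/eqP.
  by rewrite scaler_eq0 (negbTE (A_neq0 w0 (indep_neq0 vw))) orbF => /eqP ->.
have vw0 : f0 (v + w) = 0 by rewrite linearD /= v0 w0 addr0.
have vwn0 : v + w != 0.
  by apply/eqP => /eqP; rewrite addrC addr_eq0 -scaleN1r => /eqP; exact: vw.
have [r] := A_scale t vw0 vwn0.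
have tvw c : t *: w <> c *: (t *: v).
  by move=> E; apply: (vw (t^-1 * c * t)); rewrite -!scalerA -E scalerA mulVf // scale1r.
rewrite scalerDr (A_add_indep (f0Z t v0) (f0Z t w0) tvw) (A_add_indep v0 w0 vw)
  Ev Ew (scalerDr r (A v)).
by case/(coef_eq (A_indep v0 w0 vn0 vw) (A_neq0 v0 vn0)) => -> ->.
Qed.

Let exists_h : exists h : K -> K, forall t v, f0 v = 0 -> A (t *: v) = h t *: A v.
Proof.
have [w0 [w00 w0n]] := dimH 0; have w0n0 := indep_neq0 w0n.
have [h Eh] := choice (fun t => A_scale t w00 w0n0).
exists h => t v v0.
have [->|vn0] := eqVneq v 0; first by rewrite scaler0 A0 scaler0.
have [s Es] := A_scale t v0 vn0; rewrite Es; congr (_ *: _).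
have [vw|] := pselect (forall c, v <> c *: w0).
  by symmetry; apply: h_indep vw (Eh t) Es.
move=> /existsNP[c /contrapT vc].
(* Here [v] is a multiple of [w0]; a vector independent of [w0], hence of [v], relays the scaling
   factor. *)
have [w [w_0 ww]] := dimH w0.
have [s' Es'] := A_scale t w_0 (indep_neq0 ww).
rewrite (h_indep w00 w_0 w0n0 ww (Eh t) Es').
apply: h_indep v0 w_0 vn0 _ Es Es' => d.
by rewrite vc scalerA; exact: ww.
Qed.

Let A_add v w : f0 v = 0 -> f0 w = 0 -> A (v + w) = A v + A w.
Proof.
move=> v0 w0; have [vw|] := pselect (forall c, w <> c *: v).
  exact: A_add_indep.
move=> /existsNP[t /contrapT wt].
have [->|vn0] := eqVneq v 0; first by rewrite A0 !add0r.
(* For dependent [v] and [w], a vector [u] off their line reduces the claim to independent pairs: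
   [A] of [v + w + u] is expanded with both bracketings and [A u] is cancelled. *)
have [u [u0 uv]] := dimH v.
have ind c : (forall d, c *: v + u <> d *: v).
  by move=> d E; apply: (uv (d - c)); rewrite scalerBl -E addrAC subrr add0r.
have indZ c : (forall d, u <> d *: (c *: v)).
  by move=> d; rewrite scalerA; exact: uv.
have uvw : forall c, u <> c *: (v + w).
  by move=> c; rewrite wt -{1}[v]scale1r -scalerDl; exact: indZ.
have vw0 : f0 (v + w) = 0 by rewrite linearD /= v0 w0 addr0.
have wu0 : f0 (w + u) = 0 by rewrite linearD /= w0 u0 addr0.
have wu : forall d, w + u <> d *: v by rewrite wt.
have uw : forall d, u <> d *: w by rewrite wt.
apply: (addIr (A u)); rewrite -(A_add_indep vw0 u0 uvw) -addrA.
by rewrite (A_add_indep v0 wu0 wu) (A_add_indep w0 u0 uw) addrA.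
Qed.

(** The fundamental theorem of projective geometry. On [ker f0] the map [A] is already
    [h]-semilinear; what remains is to extend it along [e] and to show that [h] is onto. *)
Theorem collineation_semilinear :
  exists (L : X -> X) (h : {rmorphism K -> K}),
    [/\ bijective L, bijective h, {morph L : x y / x + y},
        (forall t x, L (t *: x) = h t *: L x) &
        forall x, x != 0 -> exists c, alpha x = c *: L x].
Proof.
have [h Ah] := exists_h.
have [w [w0 wn]] := dimH 0; have wn0 := indep_neq0 wn.
have Aw := A_neq0 w0 wn0.
have Awinj s t : s *: A w = t *: A w -> s = t.
  by move/eqP; rewrite -subr_eq0 -scalerBl scaler_eq0 (negbTE Aw) orbF subr_eq0 => /eqP.
have hD s t : h (s + t) = h s + h t.
  by apply: Awinj; rewrite -Ah // scalerDl A_add ?f0Z // !Ah // scalerDl.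
have hM s t : h (s * t) = h s * h t.
  by apply: Awinj; rewrite -Ah // -scalerA Ah ?f0Z // Ah // scalerA.
have h1 : h 1 = 1 by apply: Awinj; rewrite -Ah // !scale1r.
have h0 : h 0 = 0 by apply: (addrI (h 0)); rewrite -hD !addr0.
have hB : {morph h : s t / s - t}.
  by move=> s t; apply: (addIr (h t)); rewrite -hD !subrK.
pose hm : {rmorphism K -> K} := HB.pack h
  (GRing.isZmodMorphism.Build _ _ h hB)
  (GRing.isMonoidMorphism.Build _ _ h (h1, hM)).
pose H x := x - f0 x *: e.
have fH x : f0 (H x) = 0 by rewrite linearB linearZ /= f0e mulr1 subrr.
have HD x y : H (x + y) = H x + H y.
  by rewrite /H linearD /= scalerDl opprD addrACA.
have HZ t x : H (t *: x) = t *: H x.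
  by rewrite /H scalarZ scalerBr scalerA.
(* The semilinear extension of [A] sending [e] to [N e], with [H] the projection onto [ker f0] along
   [e]. *)
pose L x := h (f0 x) *: N e + A (H x).
have LD : {morph L : x y / x + y}.
  by move=> x y; rewrite /L HD A_add // linearD /= hD scalerDl addrACA.
have LZ t x : L (t *: x) = h t *: L x.
  by rewrite /L HZ Ah // scalarZ hM [RHS]scalerDr scalerA.
have NL v : f0 v = 0 -> N (e + v) = L (e + v).
  move=> v0; rewrite /L /H linearD /= f0e v0 addr0 h1 !scale1r.
  have -> : e + v - e = v by rewrite addrAC subrr add0r.
  by rewrite [RHS]addrC /A subrK.
have split x : f0 x != 0 -> exists2 v, f0 v = 0 & x = f0 x *: (e + v).
  move=> x0; exists ((f0 x)^-1 *: x - e).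
    by rewrite linearB linearZ /= f0e mulVf // subrr.
  by rewrite addrC subrK scalerA mulfV // scale1r.
have La x : x != 0 -> exists c, alpha x = c *: L x.
  move=> xn0; have [x0|x0] := eqVneq (f0 x) 0.
    have -> : L x = A x by rewrite /L /H x0 h0 !scale0r add0r subr0.
    have [c c0 ->] := direction_alpha x0 xn0; exists c^-1.
    by rewrite scalerA mulVf // scale1r.
  have [v v0 xv] := split x x0.
  have [d ->] := alpha_scale (f0_neq0 (f0ev v0)) xn0 xv.
  exists (d * g0 (alpha (e + v)) / h (f0 x)).
  rewrite xv LZ scalerA -NL // /N scalerA; congr (_ *: _).
  have hx : h (f0 x) != 0 by rewrite -[h]/(hm : K -> K) fmorph_eq0.
  rewrite -xv divfK // mulfK // g0ev //.
have L0 x : L x = 0 -> x = 0.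
  move=> Lx; apply/eqP; apply: contraT => xn0.
  by have [c E] := La x xn0; have := alpha0 xn0; rewrite E Lx scaler0 eqxx.
have LN x : L (- x) = - L x.
  by apply/eqP; rewrite -addr_eq0 -LD addrC subrr /L /H linear0 !scale0r subr0 h0 A0 scale0r addr0.
have Linj : injective L.
  by move=> x y E; apply/eqP; rewrite -subr_eq0; apply/eqP/L0; rewrite LD LN E subrr.
(* The vector [N e + s *: A w] lies in the chart [g0 = 1], so it is [N (e + v)] for some [v] in
   [ker f0]; then [A v = s *: A w], so [v = t *: w] and [h t = s]. *)
have hsurj s : exists t, h t = s.
  have g1 : g0 (N e + s *: A w) = 1 by rewrite linearD (scalarZ g0 s) g0Ne g0A // mulr0 addr0.
  have u0 : N e + s *: A w != 0.
    by apply: contraTneq (oner_neq0 K) => u0; rewrite -g1 u0 linear0 eqxx.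
  have [y [c [yn0 E]]] := alpha_surj u0.
  have fy : f0 y != 0.
    apply: contraTneq (oner_neq0 K) => fy; rewrite negbK -g1 E scalarZ.
    have /eqP -> : g0 (alpha y) == 0 by rewrite -alpha_ker // fy.
    by rewrite mulr0.
  have [v v0 yv] := split y fy.
  have [k Ek] := La y yn0.
  move: E; rewrite Ek {1}yv LZ !scalerA -NL //; set d := (X in _ = X *: _) => E.
  have := congr1 g0 E; rewrite g1 (scalarZ g0 d) g0N // mulr1.
  move=> d1; move: E; rewrite -d1 scale1r => E.
  have Av : A v = s *: A w by rewrite {1}/A -E addrAC subrr add0r.
  have [t vt] := A_dep w0 v0 wn0 Av.
  by exists t; apply: Awinj; rewrite -Ah // -vt Av.
have hinj : injective h by exact: (fmorph_inj hm).
exists L, hm; split => //.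
- have Lsurj u : exists x, L x = u.
    have [->|un0] := eqVneq u 0.
      by exists 0; apply: (addrI (L 0)); rewrite -LD !addr0.
    have [x [c [xn0 ->]]] := alpha_surj un0.
    have [d ->] := La x xn0; have [t ht] := hsurj (c * d).
    by exists (t *: x); rewrite LZ ht scalerA.
  have [M LM] := choice Lsurj; exists M => // x.
  by apply: Linj; rewrite LM.
- have [k hk] := choice hsurj; exists k => // t.
  by apply: hinj; rewrite hk.
Qed.
End Collineation.

(** * Spans and separating functionals *)

Section Span.
Variables (K : fieldType) (V : lmodType K).

(** The span of a list, by recursion on the list, suits arguments that adjoin one vector at a time
    and needs no independence. *)
Fixpoint in_span (s : seq V) (y : V) : Prop :=
  if s is x :: s' then exists c, in_span s' (y - c *: x) else y = 0.

Lemma in_span0 s : in_span s 0.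
Proof. by elim: s => //= x s IH; exists 0; rewrite scale0r subr0. Qed.

Lemma in_spanZ s a y : in_span s y -> in_span s (a *: y).
Proof.
elim: s y => [|x s IH] y /=; first by move=> ->; rewrite scaler0.
by case=> c /IH; rewrite scalerBr scalerA; exists (a * c).
Qed.

Lemma in_spanD s y z : in_span s y -> in_span s z -> in_span s (y + z).
Proof.
elim: s y z => [|x s IH] y z /=; first by move=> -> ->; rewrite addr0.
move=> [c yc] [d zd]; exists (c + d).
by rewrite scalerDl opprD addrACA; exact: IH.
Qed.

Lemma in_span2 u v w :
  in_span [:: u; v] w <-> exists a b, w = a *: u + b *: v.
Proof.
split=> [[a [b /eqP]]|[a [b ->]]].
  by rewrite -addrA -opprD subr_eq0 => /eqP ->; exists a, b.
by exists a, b; rewrite -addrA -opprD subrr.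
Qed.

Lemma in_span_ker (f : {scalar V}) s y :
  (forall x, x \in s -> f x = 0) -> in_span s y -> f y = 0.
Proof.
elim: s y => [|x s IH] y fs /=; first by move=> ->; rewrite linear0.
case=> c /IH; rewrite linearB scalarZ fs ?mem_head // mulr0 subr0; apply => z zs.
by rewrite fs // in_cons zs orbT.
Qed.

(** A basis is built along the list: the head is added only when it is outside the span of the
    tail. *)
Lemma in_span_basis s : exists n (e : 'I_n -> V),
  lin_indep e /\ lin_span e = in_span s :> set V.
Proof.
elim: s => [|x s [n [e [ei es]]]].
  exists 0%N, (fun=> 0); split; first by move=> c _ [].
  by apply/seteqP; split=> y /= => [[c _ <-]|->]; [|exists (fun=> 0) => //]; rewrite big_ord0.
have [xs|xs] := pselect (in_span s x).
  exists n, e; split=> //; rewrite es; apply/seteqP; split=> y /=.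
    by exists 0; rewrite scale0r subr0.
  by move=> [c ys]; rewrite -(subrK (c *: x) y); exact: in_spanD ys (in_spanZ c xs).
exists n.+1, (fun i => if unlift ord0 i is Some j then e j else x); split.
  move=> c; rewrite big_ord_recl unlift_none.
  under eq_bigr do rewrite liftK.
  move=> E; have c0 : c ord0 = 0.
    apply/eqP; apply: contra_notT xs => c0.
    have -> : x = - (c ord0)^-1 *: \sum_(i < n) c (lift ord0 i) *: e i.
      move/eqP: E; rewrite addr_eq0 => /eqP E.
      by rewrite scaleNr -scalerN -E scalerA mulVf // scale1r.
    apply: in_spanZ; rewrite -[in_span s]es.
    by exists (fun i => c (lift ord0 i)).
  move=> i; case: (unliftP ord0 i) => [j ->|-> //].
  by apply: (ei (fun j => c (lift ord0 j))); move: E; rewrite c0 scale0r add0r.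
apply/seteqP; split=> y /=.
  case=> c _ <-; rewrite big_ord_recl unlift_none; exists (c ord0).
  rewrite addrAC subrr add0r -[in_span s]es.
  by under eq_bigr do rewrite liftK; exists (fun i => c (lift ord0 i)).
case=> c; rewrite -[in_span s]es => -[d _ yd].
exists (fun i => if unlift ord0 i is Some j then d j else c) => //.
rewrite big_ord_recl unlift_none.
by under eq_bigr do rewrite !liftK; rewrite yd addrC subrK.
Qed.

Lemma infinite_dim_span s : infinite_dim V -> exists x, ~ in_span s x.
Proof.
move=> Vinf; apply: contrapT => /forallNP sV; apply: Vinf.
have [n [e [ei es]]] := in_span_basis s; exists n, e; split=> //.
by rewrite es; apply/seteqP; split=> // x _; apply: contrapT; exact: sV.
Qed.

Lemma indep3_span2 (u v : V) : dim_ge V 3 -> exists w, ~ in_span [:: u; v] w.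
Proof.
move=> [e ei]; apply: contrapT => /forallNP uvV.
have {}uvV x : exists ab : K * K, x = ab.1 *: u + ab.2 *: v.
  by have /contrapT/in_span2[a [b E]] := uvV x; exists (a, b).
have [ab abE] := choice (fun i => uvV (e i)).
(* Rows are the coordinates of three independent vectors on [u] and [v]. The rank is at most two, so
   a nonzero row vector annihilates [M] from the left and gives a forbidden relation. *)
pose M : 'M[K]_(3, 2) := \matrix_(i, j) if j == 0 then (ab i).1 else (ab i).2.
have /rowV0Pn[c /sub_kermxP cM c0] : kermx M != 0.
  by rewrite kermx_eq0 /row_free neq_ltn (leq_ltn_trans (rank_leq_col M)).
case/negP: c0; apply/eqP/rowP => i; rewrite mxE.
apply: (ei (fun i => c 0 i)).
under eq_bigr do rewrite abE scalerDr !scalerA.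
rewrite big_split -!scaler_suml /=.
have cME j : \sum_i c 0 i * M i j = 0 by have /rowP/(_ j) := cM; rewrite !mxE.
have -> : \sum_i c 0 i * (ab i).1 = 0.
  by rewrite -[RHS](cME 0); apply: eq_bigr => j _; rewrite mxE.
have -> : \sum_i c 0 i * (ab i).2 = 0.
  by rewrite -[RHS](cME 1); apply: eq_bigr => j _; rewrite mxE.
by rewrite !scale0r addr0.
Qed.
End Span.

Section Functionals.
Variables (K : numFieldType) (X : normedModType K).

Definition bounded_functional (f : {scalar X}) : Prop :=
  exists M, forall x, `|f x| <= M * `|x|.

(** The one consequence of Hahn-Banach that the algebraic part requires, kept as a hypothesis so
    that real and complex spaces share that part. *)
Definition functionals_separate : Prop :=
  forall x : X, x != 0 -> exists2 f : {scalar X}, bounded_functional f & f x != 0.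

Lemma bounded_functional_lincomb (f g : {scalar X}) a b :
  bounded_functional f -> bounded_functional g ->
  exists2 k : {scalar X}, bounded_functional k & forall x, k x = a * f x + b * g x.
Proof.
move=> [M fM] [N gN]; pose k x := a * f x + b * g x.
have kl : scalar k.
  by move=> c x y; rewrite /k !linearD !scalarZ /= !mulrDr addrACA !(mulrCA c).
pose k' : {scalar X} := HB.pack k (GRing.isLinear.Build _ _ _ _ k kl).
exists k' => //; exists (`|a| * M + `|b| * N) => x.
rewrite mulrDl (le_trans (ler_normD _ _)) // !normrM -!mulrA.
by apply: lerD; apply: ler_wpM2l.
Qed.

Hypothesis sepX : functionals_separate.

(** Induction on the list: a functional [g] that kills the tail is corrected by a multiple of a
    functional [f] with [f x = 1] that also kills the tail. *)
Lemma separate_span (s : seq X) y : ~ in_span s y ->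
  exists2 f : {scalar X}, bounded_functional f &
    (forall x, x \in s -> f x = 0) /\ f y = 1.
Proof.
elim: s y => [|x s IH] y /=.
  move=> /eqP/sepX[f bf fy].
  have [k bk kE] := bounded_functional_lincomb (f y)^-1 0 bf bf.
  by exists k => //; split=> //; rewrite kE mul0r addr0 mulVf.
move=> ys; have [xs|/IH[f bf [fs fx]]] := pselect (in_span s x).
  have /IH[f bf [fs fy]] : ~ in_span s y.
    by move=> ys'; apply: ys; exists 0; rewrite scale0r subr0.
  exists f => //; split=> // z; rewrite in_cons => /predU1P[->|/fs//].
  exact: in_span_ker xs.
(* With [k = g - g x * f], the value [k x] is [0] and [k y = g (y - f y *: x) = 1]. *)
have /IH[g bg [gs gy]] : ~ in_span s (y - f y *: x).
  by move=> H; apply: ys; exists (f y).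
have [k bk kE] := bounded_functional_lincomb 1 (- g x) bg bf.
exists k => //; split=> [z|].
  rewrite in_cons kE => /predU1P[->|zs]; first by rewrite fx mul1r mulr1 subrr.
  by rewrite gs // fs // !mulr0 addr0.
by rewrite kE mul1r mulNr -gy linearB scalarZ [f y * _]mulrC.
Qed.

Lemma separate_point (u : X) : u != 0 ->
  exists2 f : {scalar X}, bounded_functional f & f u = 1.
Proof.
move=> u0; have [|f bf [_ fu]] := @separate_span [::] u; first exact/eqP.
by exists f.
Qed.

Lemma idempotent_tensor (u : X) (f : {scalar X}) : bounded_functional f -> f u = 1 ->
  exists P : rank_one_idempotent X, \val P = fun x => f x *: u.
Proof.
move=> [M fM] fu; have PP : rank_one_idempotent X (fun x => f x *: u).
  split.
  - split; first by move=> c x y; rewrite linearD scalarZ /= scalerDl scalerA.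
    by exists (M * `|u|) => x; rewrite normrZ mulrAC ler_wpM2r.
  - by apply/funext => x /=; rewrite scalarZ fu mulr1.
  exists (fun=> u); split.
    move=> c; rewrite big_ord1 => /eqP; rewrite scaler_eq0 => /orP[/eqP c0 i|/eqP u0].
      by rewrite ord1.
    by move: fu; rewrite u0 linear0 => /esym/eqP; rewrite oner_eq0.
  apply/seteqP; split=> y /=.
    by case=> c _; rewrite big_ord1 => <-; exists (c ord0 *: u) => //; rewrite scalarZ fu mulr1.
  by case=> x _ <-; exists (fun=> f x) => //; rewrite big_ord1.
by exists (@SigSub _ _ _ _ (mem_set PP)).
Qed.

Lemma idempotent_tensorP (P : rank_one_idempotent X) :
  exists uf : X * {scalar X}, [/\ bounded_functional uf.2, uf.2 uf.1 = 1 &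
    \val P = fun x => uf.2 x *: uf.1].
Proof.
have /set_mem [[Pl [M PM]] PP [e [ei eP]]] := valP P.
set p := \val P in Pl PM PP eP *.
pose u := e ord0.
have u0 : u != 0.
  apply/eqP => u0; have := ei (fun=> 1).
  by rewrite big_ord1 -/u u0 scaler0 => /(_ erefl ord0)/eqP; rewrite oner_eq0.
have Pu x : exists c, p x = c *: u.
  have : range p (p x) by exists x.
  by rewrite -eP => -[c _ <-]; exists (c ord0); rewrite big_ord1.
have [f fE] := choice Pu.
have uinj s t : s *: u = t *: u -> s = t.
  by move/eqP; rewrite -subr_eq0 -scalerBl scaler_eq0 (negbTE u0) orbF subr_eq0 => /eqP.
have fl : scalar f.
  by move=> c x y; apply: uinj; rewrite -fE Pl !fE scalerDl scalerA.
pose f' : {scalar X} := HB.pack f (GRing.isLinear.Build _ _ _ _ f fl).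
exists (u, f'); split=> /=.
(* [f] is bounded because the norm of [p x] is that of [f x] times that of [u]. *)
- exists (M / `|u|) => x; rewrite mulrAC ler_pdivlMr ?normr_gt0 //.
  by rewrite -normrZ -fE.
- have : range p u by rewrite -eP; exists (fun=> 1) => //; rewrite big_ord1 scale1r.
  move=> [x _ px]; apply: uinj; rewrite scale1r -fE -{1}px.
  by rewrite -[RHS]px -[in RHS]PP.
- by apply/funext.
Qed.
End Functionals.

(** * Maps of rank-one idempotents preserving zero products *)

Section IdempotentMaps.
Variables (K : numFieldType) (X : normedModType K).
Hypothesis sepX : functionals_separate X.
Notation I1 := (rank_one_idempotent X).

(** Vector and functional of an idempotent are determined up to inverse scalars; a single choice
    yields the pair, so that they stay normalised by [fn P (vec P) = 1]. *)
Definition idempotent_vec (P : I1) : X := (sval (cid (idempotent_tensorP P))).1.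
Definition idempotent_fun (P : I1) : {scalar X} := (sval (cid (idempotent_tensorP P))).2.
Local Notation vec := idempotent_vec.
Local Notation fn := idempotent_fun.

Lemma idempotentE (P : I1) x : \val P x = fn P x *: vec P.
Proof. by rewrite /vec /fn; case: cid => uf [_ _ /= ->]. Qed.

Lemma fn_bounded P : bounded_functional (fn P).
Proof. by rewrite /fn; case: cid => uf []. Qed.

Lemma fn_vec P : fn P (vec P) = 1.
Proof. by rewrite /vec /fn; case: cid => uf [_ /= ? _]. Qed.

Lemma vec_neq0 P : vec P != 0.
Proof.
by apply: contraTneq (oner_neq0 K) => u0; rewrite -(fn_vec P) u0 linear0 eqxx.
Qed.

Lemma mul_idempotent_eq0 (P Q : I1) : \val P \o \val Q = cst 0 <-> fn P (vec Q) = 0.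
Proof.
split=> [/(congr1 (fun T => T (vec Q)))|PQ].
  rewrite /= !idempotentE fn_vec scale1r => /eqP.
  by rewrite scaler_eq0 (negbTE (vec_neq0 P)) orbF => /eqP.
by apply/funext => x /=; rewrite !idempotentE scalarZ PQ mulr0 scale0r.
Qed.

(** The chosen pair of [x |-> f x *: u] agrees with [u] and [f] up to nonzero scalars, which
    vanishing conditions do not see. *)
Lemma idempotent_with (u : X) (f : {scalar X}) : bounded_functional f -> f u = 1 ->
  exists P : I1, (exists2 c, c != 0 & vec P = c *: u) /\
                 (exists2 c, c != 0 & forall x, fn P x = c * f x).
Proof.
move=> bf fu; have [P PE] := idempotent_tensor bf fu.
have Px x : fn P x *: vec P = f x *: u by rewrite -idempotentE PE.
have u0 : u != 0.
  by apply: contraTneq (oner_neq0 K) => u0; rewrite -fu u0 linear0 eqxx.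
have vu : vec P = f (vec P) *: u by rewrite -Px fn_vec scale1r.
have c0 : f (vec P) != 0.
  by apply: contraTneq (vec_neq0 P) => c0; rewrite vu c0 scale0r eqxx.
exists P; split; first by exists (f (vec P)).
exists (f (vec P))^-1; first by rewrite invr_eq0.
move=> x; have /eqP := Px x; rewrite vu scalerA -subr_eq0 -scalerBl.
rewrite scaler_eq0 (negbTE u0) orbF subr_eq0 => /eqP <-.
by rewrite -vu mulrCA mulVf ?mulr1.
Qed.

(** Otherwise some bounded [f] kills [vec (phi P)] and [vec (phi Q)] but not [vec (phi R)]. For an
    idempotent [S] with functional proportional to [f], the functional of [psi S] then kills [vec P]
    and [vec Q], hence [vec R], a contradiction. *)
Lemma map_in_span (phi psi : I1 -> I1) : cancel psi phi ->
  preserves_zero_products phi -> forall P Q R,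
  in_span [:: vec P; vec Q] (vec R) ->
  in_span [:: vec (phi P); vec (phi Q)] (vec (phi R)).
Proof.
move=> psiK phi0 P Q R PQR; apply: contrapT => /(separate_span sepX)[f bf [f0 f1]].
have [S [_ [c c0 fS]]] := idempotent_with bf f1.
have SE T : fn (psi S) (vec T) = 0 <-> f (vec (phi T)) = 0.
  rewrite -mul_idempotent_eq0 phi0 psiK mul_idempotent_eq0 fS.
  by split=> [/eqP|->]; rewrite ?mulr0 // mulf_eq0 (negbTE c0) => /eqP.
have : f (vec (phi R)) = 0.
  apply/SE; apply: in_span_ker PQR => x; rewrite !inE => /orP[] /eqP ->; apply/SE.
    by apply: f0; rewrite inE eqxx.
  by apply: f0; rewrite !inE eqxx orbT.
by rewrite f1 => /eqP; rewrite oner_eq0.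
Qed.

Lemma in_span2_scale (u v w u' v' w' : X) a b c : b != 0 -> c != 0 ->
  w' = a *: w -> u = b *: u' -> v = c *: v' -> in_span [:: u; v] w -> in_span [:: u'; v'] w'.
Proof.
move=> b0 c0 -> -> -> /in_span2[s [t ->]]; apply/in_span2.
by exists (a * (s * b)), (a * (t * c)); rewrite scalerDr !scalerA !mulrA.
Qed.

Theorem idempotent_map_semilinear (phi : I1 -> I1) :
  dim_ge X 3 -> bijective phi -> preserves_zero_products phi ->
  exists (A : X -> X) (h : {rmorphism K -> K}),
    [/\ bijective A, bijective h, {morph A : x y / x + y},
        (forall t x, A (t *: x) = h t *: A x) &
        forall P x, \val (phi P) (A x) = A (\val P x)].
Proof.
move=> dimX [psi phiK psiK] phi0.
have psi0 : preserves_zero_products psi.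
  by move=> P Q; have := phi0 (psi P) (psi Q); rewrite !psiK => -[].
(* An idempotent with range spanned by [v]; for [v = 0] any idempotent will do. *)
have /choice[Pv PvE] : forall v : X, exists P : I1, v != 0 -> exists2 c, c != 0 & vec P = c *: v.
  move=> v; have [v0|v0] := boolP (v != 0).
    have [f bf fv] := separate_point sepX v0.
    by have [P [vP _]] := idempotent_with bf fv; exists P.
  have [w w0] := indep3_span2 0 0 dimX.
  have [|f bf fw] := @separate_point _ _ sepX w.
    by apply: contra_notN w0 => /eqP ->; exact: in_span0.
  by have [P _] := idempotent_with bf fw; exists P.
pose alpha v := vec (phi (Pv v)).
have alphaP u v w : u != 0 -> v != 0 -> w != 0 ->
  (exists a b, w = a *: u + b *: v) <->
  (exists a b, alpha w = a *: alpha u + b *: alpha v).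
  move=> /PvE[a a0 Eu] /PvE[b b0 Ev] /PvE[c c0 Ew].
  have inv d y z : d != 0 -> y = d *: z -> z = d^-1 *: y :> X.
    by move=> d0 ->; rewrite scalerA mulVf // scale1r.
  rewrite -!in_span2; split=> H.
    apply: (map_in_span psiK phi0).
    by apply: in_span2_scale Ew (inv _ _ _ a0 Eu) (inv _ _ _ b0 Ev) H; rewrite invr_eq0.
  apply: in_span2_scale (inv _ _ _ c0 Ew) Eu Ev _ => //.
  by have := map_in_span phiK psi0 H; rewrite !phiK.
have vec_alpha P : exists c, vec (phi P) = c *: alpha (vec P).
  have [c c0 E] := PvE _ (vec_neq0 P).
  have /(map_in_span psiK phi0)/in_span2[a [b ->]] :
      in_span [:: vec (Pv (vec P)); vec (Pv (vec P))] (vec P).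
    apply/in_span2; exists c^-1, 0; rewrite scale0r addr0 E scalerA mulVf //.
    by rewrite scale1r.
  by exists (a + b); rewrite scalerDl.
have alpha_ker P v : v != 0 -> (fn P v == 0) = (fn (phi P) (alpha v) == 0).
  move=> /PvE[c c0 Ec].
  transitivity (fn P (vec (Pv v)) == 0).
    by rewrite Ec scalarZ mulf_eq0 (negbTE c0).
  by have := phi0 P (Pv v); rewrite !mul_idempotent_eq0 => -[PQ QP]; apply/eqP/eqP.
have [w0 w0n] := indep3_span2 0 0 dimX.
pose P0 := Pv w0; pose e := vec P0.
(* A vector outside the span of [e] and [x], projected to the kernel along [e], cannot become a
   multiple of [x]. *)
have dimH x : exists w, fn P0 w = 0 /\ forall c, w <> c *: x.
  have [w wex] := indep3_span2 e x dimX.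
  exists (w - fn P0 w *: e); split.
    by rewrite linearB scalarZ fn_vec mulr1 subrr.
  move=> c E; apply: wex; apply/in_span2; exists (fn P0 w), c.
  by rewrite -E addrC subrK.
have alpha_surj (u : X) : u != 0 -> exists (v : X) c, v != 0 /\ u = c *: alpha v.
  move=> u0; have [f bf fu] := separate_point sepX u0.
  have [Q [[c c0 Qu] _]] := idempotent_with bf fu.
  have [d] := vec_alpha (psi Q); rewrite psiK Qu => E.
  exists (vec (psi Q)), (c^-1 * d); split; first exact: vec_neq0.
  by rewrite -scalerA -E scalerA mulVf // scale1r.
have [A [h [Abij hbij AD AZ Aalpha]]] := collineation_semilinear
  (fun v _ => vec_neq0 (phi (Pv v))) alphaP alpha_surj (alpha_ker P0) (fn_vec P0) dimH.
have {}Aalpha (x : X) : x != 0 -> exists c, alpha x = c *: A x := Aalpha x.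
exists A, h; split=> // P x.
have [k Ek] := vec_alpha P; have [k' Ek'] := Aalpha _ (vec_neq0 P).
move: Ek; rewrite Ek' scalerA; move: (k * k') => c Ec.
have c0 : c != 0.
  by apply: contraTneq (vec_neq0 (phi P)) => c0; rewrite Ec c0 scale0r eqxx.
have fA0 z : fn P z = 0 -> fn (phi P) (A z) = 0.
  move=> Pz; have [->|z0] := eqVneq z 0.
    have -> : A 0 = 0 by apply: (addrI (A 0)); rewrite -AD !addr0.
    exact: linear0.
  have := alpha_ker P z z0; rewrite Pz eqxx => /esym.
  have [d Ed] := Aalpha z z0; rewrite Ed scalarZ mulf_eq0 => /orP[/eqP d0|/eqP //].
  by have := vec_neq0 (phi (Pv z)); rewrite -[vec _]/(alpha z) Ed d0 scale0r eqxx.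
(* Splitting [x] along the range and kernel of [P]: [fA0] removes the kernel part, and the factor
   left on the range is [c * fn (phi P) (A (vec P)) = fn (phi P) (vec (phi P)) = 1]. *)
have xE : x = fn P x *: vec P + (x - fn P x *: vec P) by rewrite addrC subrK.
rewrite !idempotentE {1}xE AD linearD /= [X in _ + X]fA0; last first.
  by rewrite linearB scalarZ fn_vec mulr1 subrr.
rewrite addr0 !AZ scalarZ Ec scalerA -mulrA; congr (_ *: _).
by rewrite -{2}(mulr1 (h _)); congr (_ * _); rewrite mulrC -scalarZ -Ec fn_vec.
Qed.

(** The functional [h o f o A^-1] is bounded because, up to a scalar, it is the functional of
    [phi P], where [P] has functional proportional to [f]. *)
Lemma semilinear_functional (phi : I1 -> I1) (A : X -> X) (h : {rmorphism K -> K}) :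
  bijective A -> {morph A : x y / x + y} ->
  (forall t x, A (t *: x) = h t *: A x) ->
  (forall P x, \val (phi P) (A x) = A (\val P x)) ->
  forall f : {scalar X}, bounded_functional f ->
  exists2 g : {scalar X}, bounded_functional g & forall x, g (A x) = h (f x).
Proof.
move=> [B AK BK] AD AZ phiA f bf.
have A0 : A 0 = 0 by apply: (addrI (A 0)); rewrite -AD !addr0.
have [f0|/existsNP[u /eqP fu]] := pselect (forall x, f x = 0).
  by exists f => // x; rewrite !f0 rmorph0.
have [f' bf' f'E] := bounded_functional_lincomb (f u)^-1 0 bf bf.
have f'u : f' u = 1 by rewrite f'E mul0r addr0 mulVf.
have [P PE] := idempotent_tensor bf' f'u.
have gA x : fn (phi P) (A x) *: vec (phi P) = h (f' x) *: A u.
  by rewrite -idempotentE phiA PE AZ.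
have v0 := vec_neq0 (phi P).
have vE : vec (phi P) = h (f' (B (vec (phi P)))) *: A u.
  by rewrite -gA BK fn_vec scale1r.
set c := h _ in vE.
have Au0 : A u != 0 by apply: contraTneq v0 => Au; rewrite vE Au scaler0 eqxx.
(* As [vec (phi P) = c *: A u], the product [c * fn (phi P) (A x)] is [h (f' x)]; the factor
   [h (f u)] undoes the normalisation of [f]. *)
have [g bg gE] := bounded_functional_lincomb (h (f u) * c) 0
  (fn_bounded (phi P)) (fn_bounded (phi P)).
exists g => // x; rewrite gE mul0r addr0.
have /eqP := gA x; rewrite vE scalerA -subr_eq0 -scalerBl.
rewrite scaler_eq0 (negbTE Au0) orbF subr_eq0 => /eqP cE.
rewrite -mulrA [c * _]mulrC cE f'E mul0r addr0 -rmorphM.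
by rewrite mulrA mulfV // mul1r.
Qed.

Lemma semilinear_functional_inv (phi : I1 -> I1) (A : X -> X) (h : {rmorphism K -> K}) :
  bijective phi -> bijective A -> bijective h -> {morph A : x y / x + y} ->
  (forall t x, A (t *: x) = h t *: A x) ->
  (forall P x, \val (phi P) (A x) = A (\val P x)) ->
  forall g : {scalar X}, bounded_functional g ->
  exists2 f : {scalar X}, bounded_functional f & forall x, g (A x) = h (f x).
Proof.
move=> [psi phiK psiK] [B AK BK] [h' hK h'K] AD AZ phiA g bg.
have [g0|/existsNP[u /eqP gu]] := pselect (forall x, g x = 0).
  by exists g => // x; rewrite !g0 rmorph0.
have [g' bg' g'E] := bounded_functional_lincomb (g u)^-1 0 bg bg.
have g'u : g' u = 1 by rewrite g'E mul0r addr0 mulVf.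
have [Q QE] := idempotent_tensor bg' g'u.
pose P := psi Q; pose v := vec P.
have gA x : g' (A x) *: u = h (fn P x) *: A v.
  by have := phiA P x; rewrite psiK QE => ->; rewrite idempotentE AZ.
have u0 : u != 0 by apply: contraTneq gu => ->; rewrite linear0 eqxx.
have Av : A v = g' (A v) *: u by rewrite gA fn_vec rmorph1 scale1r.
(* The scalar is pulled back through [h], since [h] is applied to [f]. *)
have [f bf fE] := bounded_functional_lincomb (h' (g u * g' (A v))) 0 (fn_bounded P) (fn_bounded P).
exists f => // x; rewrite fE mul0r addr0 rmorphM h'K.
have /eqP : g' (A x) *: u = (h (fn P x) * g' (A v)) *: u by rewrite gA {1}Av scalerA.
rewrite -subr_eq0 -scalerBl.
rewrite scaler_eq0 (negbTE u0) orbF subr_eq0 => /eqP cE.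
by rewrite -mulrA (mulrC (g' (A v))) -cE g'E mul0r addr0 mulrA mulfV // mul1r.
Qed.

End IdempotentMaps.

(** * The Hahn-Banach theorem *)

Section HahnBanach.
(** Real scalars act on [V] through [i], so that one proof serves real spaces and the underlying
    real spaces of complex ones. *)
Variables (R : realType) (K : fieldType) (i : {rmorphism R -> K}) (V : lmodType K).

(* Equality in the homogeneity axiom follows by applying it to [t^-1]. *)
Definition sublinear (q : V -> R) : Prop :=
  (forall x y, q (x + y) <= q x + q y) /\
  (forall t x, 0 < t -> q (i t *: x) <= t * q x).

Lemma sublinear0 q : sublinear q -> q 0 = 0.
Proof.
move=> [_ qZ]; have q2 : q (i 2 *: 0) <= 2 * q 0 by exact: qZ.
have qh : q (i 2^-1 *: 0) <= 2^-1 * q 0 by apply: qZ; rewrite invr_gt0.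
by move: q2 qh; rewrite !scaler0; lra.
Qed.

Lemma sublinearZ q t x : sublinear q -> 0 <= t -> q (i t *: x) = t * q x.
Proof.
move=> ql; rewrite le_eqVlt => /predU1P[<-|t0].
  by rewrite rmorph0 scale0r mul0r sublinear0.
have [_ qZ] := ql; apply/eqP; rewrite eq_le qZ //=.
have := qZ t^-1 (i t *: x); rewrite invr_gt0 => /(_ t0).
rewrite scalerA -rmorphM mulVf ?gt_eqF // rmorph1 scale1r => /(ler_wpM2l (ltW t0)).
by rewrite mulrA mulfV ?gt_eqF // mul1r.
Qed.

Lemma sublinear_oppr q x : sublinear q -> - q (- x) <= q x.
Proof.
by move=> ql; have := ql.1 x (- x); rewrite subrr sublinear0 //; lra.
Qed.

Lemma inf_le (E : set R) m r : (forall a, E a -> m <= a) -> E r -> inf E <= r.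
Proof. by move=> Em Er; apply: ge_inf => //; exists m. Qed.

(** The classical reduction of [q] in the direction [y]: a sublinear functional below [q] whose
    value at [- y] is at most [- q y]. A minimal [q] is unchanged by it, hence additive. *)
Definition sublinear_shift (q : V -> R) (y x : V) : R :=
  inf [set r | exists2 t, 0 <= t & r = q (x + i t *: y) - t * q y].

Lemma sublinear_shift_le q y x t : sublinear q -> 0 <= t ->
  sublinear_shift q y x <= q (x + i t *: y) - t * q y.
Proof.
move=> ql t0; apply: (@inf_le _ (- q (- x))); last by exists t.
move=> _ [s s0 ->]; rewrite -(sublinearZ y ql s0).
have := ql.1 (- x) (x + i s *: y); rewrite addrA addrC addNr addr0; lra.
Qed.

Lemma sublinear_shift_ge q y x m : sublinear q ->
  (forall t, 0 <= t -> m <= q (x + i t *: y) - t * q y) -> m <= sublinear_shift q y x.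
Proof.
move=> ql H; apply: lb_le_inf; first by exists (q (x + i 0 *: y) - 0 * q y), 0.
by move=> _ [t t0 ->]; exact: H.
Qed.

Lemma sublinear_shiftP q y : sublinear q -> sublinear (sublinear_shift q y).
Proof.
move=> ql; split=> [x x'|s x s0].
  rewrite -lerBlDr; apply: sublinear_shift_ge => // t t0.
  rewrite lerBlDl -lerBlDr; apply: sublinear_shift_ge => // t' t'0.
  rewrite lerBlDr; have := sublinear_shift_le y (x + x') ql (addr_ge0 t0 t'0).
  rewrite rmorphD scalerDl addrACA.
  by have := ql.1 (x + i t *: y) (x' + i t' *: y); lra.
rewrite -ler_pdivrMl //; apply: sublinear_shift_ge => // t t0.
rewrite ler_pdivrMl //; have := sublinear_shift_le y (i s *: x) ql (mulr_ge0 (ltW s0) t0).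
by rewrite rmorphM -scalerA -scalerDr (sublinearZ _ ql (ltW s0)) mulrBr mulrA.
Qed.

Lemma minimal_sublinear (p : V -> R) : sublinear p ->
  exists q, [/\ sublinear q, forall x, q x <= p x &
    forall q', sublinear q' -> (forall x, q' x <= q x) -> forall x, q x <= q' x].
Proof.
move=> pl; pose T := {q : V -> R | sublinear q /\ forall x, q x <= p x}.
(* The order is reversed, so Zorn's maximal elements are the minimal sublinear functionals. *)
pose le (q q' : T) := `[< forall x, sval q' x <= sval q x >].
have [||A Atot|[q [ql qp]] qmin] := @ZL_preorder T (exist _ p (conj pl (fun=> lexx _))) le.
- by move=> t; apply/asboolP.
- move=> r s t /asboolP rs /asboolP st; apply/asboolP => x.
  exact: le_trans (st x) (rs x).
- have [A0|/set0P[a Aa]] := eqVneq A set0.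
    by exists (exist _ p (conj pl (fun=> lexx _))) => s; rewrite A0.
  pose E x := [set r | exists2 s : T, A s & r = sval s x].
  pose q x := inf (E x).
  have qle (s : T) x : A s -> q x <= sval s x.
    move=> As; apply: (@inf_le _ (- p (- x))); last by exists s.
    move=> _ [u _ ->]; have [ul up] := svalP u.
    by have := sublinear_oppr x ul; have := up (- x); lra.
  have qge m x : (forall s, A s -> m <= sval s x) -> m <= q x.
    move=> H; apply: lb_le_inf; first by exists (sval a x), a.
    by move=> _ [s As ->]; exact: H.
  have ql : sublinear q.
    split=> [x y|t x t0].
      rewrite -lerBlDr; apply: (qge) => s As; rewrite lerBlDl -lerBlDr.
      apply: (qge) => u Au; rewrite lerBlDr.
      have [[sD _] _] := svalP s; have [[uD _] _] := svalP u.
      (* In a chain the smaller of [s] and [u] serves at both [x] and [y], so the pointwise infimum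
         is subadditive. *)
      have [/asboolP/(_ x)|/asboolP/(_ y)] := Atot _ _ As Au.
        by have := qle u (x + y) Au; have := uD x y; lra.
      by have := qle s (x + y) As; have := sD x y; lra.
    rewrite -ler_pdivrMl //; apply: (qge) => s As; rewrite ler_pdivrMl //.
    by apply: le_trans (qle s _ As) _; have [[_ sZ] _] := svalP s; exact: sZ.
  have qp x : q x <= p x by apply: le_trans (qle a x Aa) _; have [_] := svalP a.
  exists (exist _ q (conj ql qp)) => s As; apply/asboolP => x; exact: qle.
exists q; split=> // q' ql' qq'.
have qp' x : q' x <= p x by apply: le_trans (qq' x) (qp x).
have := qmin (exist _ q' (conj ql' qp')); rewrite /premaximal /le => H.
by have /asboolP := H (asboolT qq').
Qed.

(** A minimal [f] below the shift of [p] along [y] is linear, by minimality against its own shifts,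
    and [f (- y) <= - p y] forces equality at [y]. *)
Theorem hahn_banach_sublinear (p : V -> R) (y : V) : sublinear p ->
  exists f : V -> R, [/\ {morph f : x x' / x + x'},
    forall t x, f (i t *: x) = t * f x, forall x, f x <= p x & f y = p y].
Proof.
move=> pl; have [f [fl fp fmin]] := minimal_sublinear (sublinear_shiftP y pl).
have shift1 q x z : sublinear q -> sublinear_shift q z x <= q (x + z) - q z.
  move=> ql; have := sublinear_shift_le z x ql (@ler01 R).
  by rewrite rmorph1 scale1r mul1r.
have shift0 q x z : sublinear q -> sublinear_shift q z x <= q x.
  move=> ql; have := sublinear_shift_le z x ql (lexx 0).
  by rewrite rmorph0 scale0r mul0r addr0 subr0.
have fD : {morph f : x x' / x + x'}.
  move=> x z; apply/eqP; rewrite eq_le fl.1 /=.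
  have := fmin _ (sublinear_shiftP z fl) (fun x => shift0 f x z fl) x.
  by have := shift1 f x z fl; lra.
have fN x : f (- x) = - f x.
  by have := fD x (- x); rewrite subrr sublinear0 //; lra.
have fZ t x : f (i t *: x) = t * f x.
  have [t0|t0] := leP 0 t; first exact: sublinearZ.
  rewrite -[t]opprK rmorphN scaleNr fN sublinearZ ?mulNr //.
  by rewrite oppr_ge0 ltW.
have fpp x : f x <= p x by apply: le_trans (fp x) (shift0 p x y pl).
exists f; split=> //; apply/eqP; rewrite eq_le fpp /=.
have := shift1 p (- y) y pl; rewrite addNr sublinear0 //.
by have := fp (- y); rewrite fN; lra.
Qed.
End HahnBanach.

(** The functional [g] has norm at most one and attains the norm at [y]. Besides separation, this
    gives the lower estimates for uniform boundedness. *)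
Definition norming (K : numFieldType) (X : normedModType K) : Prop :=
  forall y : X, exists g : {scalar X}, (forall x, `|g x| <= `|x|) /\ `|y| <= `|g y|.

Lemma norming_separate (K : numFieldType) (X : normedModType K) :
  norming X -> functionals_separate X.
Proof.
move=> nX x x0; have [g [g1 gx]] := nX x; exists g.
  by exists 1 => z; rewrite mul1r.
by rewrite -normr_gt0 (lt_le_trans _ gx) // normr_gt0.
Qed.

Lemma norming_real (R : realType) (X : normedModType R) : norming X.
Proof.
move=> y.
have nl : sublinear (idfun : {rmorphism R -> R}) (fun x : X => `|x|).
  split=> [x x'|t x t0]; first exact: ler_normD.
  by rewrite normrZ gtr0_norm.
have [f [fD fZ fn fy]] := hahn_banach_sublinear y nl.
have {}fZ t x : f (t *: x) = t * f x := fZ t x.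
have fl : scalar f by move=> c x x'; rewrite fD; congr (_ + _); exact: fZ.
pose g : {scalar X} := HB.pack f (GRing.isLinear.Build _ _ _ _ f fl).
have f0 : f 0 = 0 by exact: (linear0 g).
exists g; split; last by rewrite -[g y]/(f y) fy normr_id.
move=> x; rewrite -[g x]/(f x) ler_norml fn andbT lerNl.
have -> : - f x = f (- x) by have := fZ (-1) x; rewrite scaleN1r mulN1r.
by rewrite -normrN.
Qed.

Lemma norming_complex (R : realType) (X : normedModType R[i]) : norming X.
Proof.
move=> y.
(* Norms are elements of [R[i]]; being nonnegative they are real, and [complex.Re] recovers them. *)
have normX (x : X) : `|x| = (complex.Re `|x|)%:C.
  apply/eqP; rewrite eq_complex /= eqxx /=; have := normr_ge0 x.
  by rewrite lecE => /andP[/eqP -> _].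
have nl : sublinear (real_complex R : {rmorphism R -> R[i]}) (fun x : X => complex.Re `|x|).
  split=> [x x'|t x t0].
    by have := ler_normD x x'; rewrite lecE => /andP[_]; rewrite raddfD.
  have tn : `|t%:C| = t%:C by rewrite ger0_norm // lecR ltW.
  by rewrite normrZ (normX x) tn -rmorphM.
have [f [fD fZ fn fy]] := hahn_banach_sublinear y nl.
have {}fZ t x : f (t%:C *: x) = t * f x := fZ t x.
have fN x : f (- x) = - f x.
  by have := fZ (-1) x; rewrite rmorphN rmorph1 scaleN1r mulN1r.
(* The complex-linear functional with real part [f], namely [f x - i f (i x)]. *)
pose g (x : X) : R[i] := f x +i* (- f ('i *: x)).
have gl : scalar g.
  move=> [a b] x x'; rewrite /g.
  have cE (z : X) : (a +i* b) *: z = a%:C *: z + b%:C *: ('i *: z).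
    rewrite scalerA -scalerDl; congr (_ *: _).
    by apply/eqP; rewrite eq_complex /=; apply/andP; split; apply/eqP; ring.
  have iE (z : X) : 'i *: ((a +i* b) *: z) = a%:C *: ('i *: z) - b%:C *: z.
    rewrite cE scalerDr !scalerA -scaleNr; congr (_ *: _ + _ *: _); first exact: mulrC.
    by apply/eqP; rewrite eq_complex /=; apply/andP; split; apply/eqP; ring.
  rewrite scalerDr iE fD (fD (_ - _)) fD cE fD !fZ fN fZ.
  apply/eqP; rewrite eq_complex /=; apply/andP; split; apply/eqP; ring.
pose g' : {scalar X} := HB.pack g (GRing.isLinear.Build _ _ _ _ g gl).
exists g'; split=> [x|].
  have [gx0|gx0] := eqVneq (g' x) 0; first by rewrite gx0 normr0.
  (* Rotating [x] by a unimodular scalar makes the value of [g'] real, where the bound on [f]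
     applies. *)
  have : g' (((g' x)^* / `|g' x|) *: x) = `|g' x|.
    rewrite scalarZ mulrAC [_^* * _]mulrC -sqr_normc expr2 mulfK ?normr_eq0 //.
  move/(congr1 (@complex.Re R)); have -> z : complex.Re (g' z) = f z by [].
  move=> E.
  have := fn (((g' x)^* / `|g' x|) *: x); rewrite E normrZ normrM normcJ normfV normr_id.
  rewrite mulfV ?normr_eq0 // mul1r => le.
  by rewrite (normX x) [`|g' x|]normc_def lecR.
rewrite (le_trans _ (normc_ge_Re _)) // -[g' y]/(g y) /g /= fy (normX y) lecR.
exact: ler_norm.
Qed.

(** * Completeness arguments *)

(** Stated through absolute values to cover [R[i]], whose order is only partial. *)
Definition norm_archimedean (K : numDomainType) : Prop :=
  forall x : K, exists n : nat, `|x| < n%:R.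

Section Completeness.
Variables (K : numFieldType) (X : completeNormedModType K).
Hypothesis archiK : norm_archimedean K.

Lemma exp2_small (e : K) : 0 < e -> exists n, 2^-1 ^+ n < e.
Proof.
move=> e0; have [n en] := archiK e^-1; exists n.
rewrite exprVn -[e]invrK ltf_pV2 ?posrE ?invr_gt0 ?exprn_gt0 //.
rewrite -(ger0_norm (ltW _ : 0 <= e^-1)) ?invr_gt0 //; apply: lt_trans en _.
by rewrite -natrX ltr_nat ltn_expl.
Qed.

Lemma telescoping_dist (u : nat -> X) (d : nat -> K) n k :
  (forall m, `|u m.+1 - u m| <= d m - d m.+1) ->
  `|u (n + k)%N - u n| <= d n - d (n + k)%N.
Proof.
move=> ud; elim: k => [|k IH]; first by rewrite addn0 !subrr normr0.
have -> : u (n + k.+1)%N - u n = (u (n + k).+1 - u (n + k)%N) + (u (n + k)%N - u n).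
  by rewrite addrA subrK addnS.
apply: le_trans (ler_normD _ _) _; apply: le_trans (lerD (ud _) IH) _.
by rewrite addnS addrC addrA subrK.
Qed.

(** [d n] dominates all later displacements and tends to [0], so the sequence is Cauchy. *)
Lemma telescoping_limit (u : nat -> X) (d : nat -> K) :
  (forall n, `|u n.+1 - u n| <= d n - d n.+1) ->
  (forall n, 0 <= d n <= 2 * 2^-1 ^+ n) ->
  exists z, forall e, 0 < e -> exists N, forall n, (N <= n)%N -> `|z - u n| < e.
Proof.
move=> ud d2.
have udm n k := telescoping_dist n k ud.
have dlim e : 0 < e -> exists n, d n < e.
  move=> e0; have [|n ne] := @exp2_small (e / 2); first by rewrite divr_gt0.
  exists n; have /andP[_ dn] := d2 n; apply: le_lt_trans dn _.
  by rewrite mulrC -ltr_pdivlMr.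
have : cvg (u @ \oo).
  suff : cauchy_ex (u @ \oo) by move=> /cauchy_exP; exact: cauchy_cvg.
  move=> e e0; have [n dn] := dlim e e0; exists (u n), n => // m /= nm.
  rewrite -ball_normE /= distrC -(subnKC nm).
  apply: le_lt_trans (udm _ _) _; apply: le_lt_trans dn.
  by rewrite gerBl; have /andP[] := d2 (n + (m - n))%N.
move=> /cvgrPdist_lt H; exists (lim (u @ \oo)) => e /H[N _ HN].
by exists N => n /HN.
Qed.

(** Baire's theorem by nested balls: every ball can be refined to one on which [P n] holds, and the
    limit of the centres lies in all the refined balls. *)
Lemma baire_nested (P : nat -> X -> Prop) :
  (forall n x r, 0 < r -> exists y s, [/\ 0 < s, s <= r / 2, `|y - x| <= r / 4 &
     forall z, `|z - y| <= s -> P n z]) ->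
  exists z, forall n, P n z.
Proof.
move=> step.
have /choice[next nextP] : forall a : nat * X * K, exists ys : X * K, 0 < a.2 ->
    [/\ 0 < ys.2, ys.2 <= a.2 / 2, `|ys.1 - a.1.2| <= a.2 / 4 &
        forall z, `|z - ys.1| <= ys.2 -> P a.1.1 z].
  move=> a; have [/(step a.1.1 a.1.2)[y [s H]]|_] := boolP (0 < a.2).
    by exists (y, s).
  by exists (0, 0).
pose b := fix b n : X * K := if n is m.+1 then next (m, (b m).1, (b m).2) else (0, 1).
have b0 n : 0 < (b n).2.
  by elim: n => [|n IH] /=; [exact: ltr01 | have [] := nextP (n, (b n).1, (b n).2) IH].
have bP n : [/\ (b n.+1).2 <= (b n).2 / 2, `|(b n.+1).1 - (b n).1| <= (b n).2 / 4 &
    forall z, `|z - (b n.+1).1| <= (b n.+1).2 -> P n z].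
  by have [] := nextP (n, (b n).1, (b n).2) (b0 n).
(* Half the radius: radii at least halve and centres move by at most a quarter radius, so the moves
   telescope against [d]. *)
pose d n := (b n).2 / 2.
have half2 (x : K) : x / 2 = x / 4 + x / 4 by field.
have ud n : `|(b n.+1).1 - (b n).1| <= d n - d n.+1.
  have [r2 r4 _] := bP n; apply: le_trans r4 _.
  rewrite /d lerBrDr (half2 (b n).2) lerD2l.
  by rewrite (_ : (b n).2 / 4 = (b n).2 / 2 / 2) ?ler_wpM2r ?invr_ge0 ?ler0n //; field.
have d2 n : 0 <= d n <= 2 * 2^-1 ^+ n.
  rewrite divr_ge0 ?(ltW (b0 n)) //=.
  have H : (b n).2 <= 2^-1 ^+ n.
    elim: n => [|n IH]; first by rewrite expr0.
    have [r2 _ _] := bP n; apply: le_trans r2 _.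
    by rewrite exprSr ler_wpM2r ?invr_ge0 ?ler0n.
  rewrite /d ler_pdivrMr // mulrAC; apply: le_trans H _.
  have h4 : 1 <= 2 * 2 :> K by rewrite -natrM ler1n.
  by rewrite ler_peMl ?exprn_ge0 ?invr_ge0 ?ler0n.
have [z zlim] := telescoping_limit ud d2.
exists z => n; have [_ _] := bP n; apply.
(* One half of the radius pays for approaching the limit, the other half for the moves of the
   centres. *)
have [N zN] := zlim ((b n.+1).2 / 2) (divr_gt0 (b0 _) (ltr0n _ 2)).
have := zN (n.+1 + N)%N (leq_addl _ _) => zb.
have bb : `|(b (n.+1 + N)%N).1 - (b n.+1).1| <= d n.+1.
  have /= H := telescoping_dist (u := fun n => (b n).1) n.+1 N ud.
  apply: le_trans H _; rewrite gerBl.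
  by have /andP[] := d2 (n.+1 + N)%N.
rewrite -[z](subrK (b (n.+1 + N)%N).1) -addrA.
apply: le_trans (ler_normD _ _) _; apply: le_trans (lerD (ltW zb) bb) _.
by rewrite /d -splitr.
Qed.
End Completeness.

(** * Uniform boundedness and the gliding hump *)

Section Boundedness.
Variables (K : numFieldType) (X : completeNormedModType K).
Hypothesis archiK : norm_archimedean K.
Hypothesis normingX : norming X.

(** A given [M] need not be real or positive; a nonzero [x] forces [0 <= M], and otherwise any
    constant works. *)
Lemma bound_gt0 (f : X -> K) : (exists M, forall x, `|f x| <= M * `|x|) ->
  exists2 M, 0 < M & forall x, `|f x| <= M * `|x|.
Proof.
move=> [M fM]; exists (`|M| + 1); first by rewrite ltr_wpDl.
move=> x; have := fM x; rewrite -[`|f x|]normr_id => H.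
have [x0|x0] := eqVneq (`|x|) 0.
  by move: H; rewrite x0 !mulr0.
have M0 : 0 <= M.
  by have := le_trans (normr_ge0 _) H; rewrite pmulr_lge0 // lt_def x0 normr_ge0.
apply: le_trans H _; rewrite ler_wpM2r // (ger0_norm M0) lerDl //.
Qed.

(** If [A] were unbounded, every ball would contain a point with large image; a norming functional
    [g] with bounded [g o A] keeps the image large on a small ball around it. Baire then yields [z]
    with [A z] of infinite norm. *)
Lemma pointwise_bounded_map (A : X -> X) (h : K -> K) :
  {morph A : x y / x + y} -> (forall t x, A (t *: x) = h t *: A x) ->
  (forall t, `|h t| = `|t|) ->
  (forall g : {scalar X}, bounded_functional g ->
     exists M, forall x, `|g (A x)| <= M * `|x|) ->
  exists M, forall x, `|A x| <= M * `|x|.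
Proof.
move=> AD AZ hn gA; apply: contrapT => /forallNP unb.
have A0 : A 0 = 0 by apply: (addrI (A 0)); rewrite -AD !addr0.
have AB x y : A (x - y) = A x - A y.
  by apply: (addIr (A y)); rewrite -AD !subrK.
have far (r c : K) : 0 < r -> 0 <= c -> exists z, `|z| <= r /\ c < `|A z|.
  move=> r0 c0; have /existsNP[x /negP] := unb (c / r).
  rewrite -real_ltNge ?realM ?realV ?normr_real ?ger0_real ?(ltW r0) // => Ax.
  have x0 : x != 0 by apply: contraTneq Ax => ->; rewrite A0 !normr0 mulr0 ltxx.
  have nx : 0 < `|x| by rewrite normr_gt0.
  exists ((r / `|x|) *: x); rewrite AZ !normrZ hn.
  rewrite normrM normfV normr_id (gtr0_norm r0) divfK ?gt_eqF //; split=> //.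
  by rewrite mulrAC ltr_pdivlMr // -ltr_pdivrMl // mulrA [_^-1 * c]mulrC.
have [z zA] : exists z, forall n, n%:R <= `|A z|; last first.
  by have [n] := archiK `|A z|; rewrite normr_id => /lt_geF; rewrite zA.
apply: (baire_nested archiK) => n x r r0.
have [y [yx yA]] : exists y, `|y - x| <= r / 4 /\ n.+1%:R <= `|A y|.
  have [z [zr zA]] := far (r / 4) (n.+1%:R + n.+1%:R)
    (divr_gt0 r0 (ltr0n _ 4)) (addr_ge0 (ler0n _ _) (ler0n _ _)).
  have [Ax|Ax] := real_leP (realn K n.+1) (normr_real (A x)).
    by exists x; rewrite subrr normr0 divr_ge0 ?(ltW r0).
  exists (x + z); rewrite addrAC subrr add0r; split=> //.
  have : `|A z| <= `|A (x + z)| + `|A x|.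
    by rewrite AD -{1}(addrK (A x) (A z)) [A z + _]addrC; exact: ler_normB.
  move/(lt_le_trans zA)/lt_le_trans/(_ (lerD (lexx _) (ltW Ax))).
  by rewrite ltrD2r => /ltW.
have [g [g1 gy]] := normingX (A y).
have bg : bounded_functional g by exists 1 => w; rewrite mul1r.
have [M M0 gM] := bound_gt0 (gA g bg).
have rM : 0 < 1 + r * M by rewrite ltr_pwDl ?ltr01 // mulr_ge0 ?ltW.
(* The radius is at most [r / 2] and, multiplied by [M], at most [1]; hence [g o A] drops by at most
   one from its size at [y], which is at least [n.+1]. *)
exists y, (r / (2 * (1 + r * M))); split=> //.
- by rewrite divr_gt0 // mulr_gt0.
- rewrite ler_wpM2l ?(ltW r0) // lef_pV2 ?posrE ?mulr_gt0 //.
  by rewrite ler_peMr // lerDl mulr_ge0 ?ltW.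
move=> z zy; apply: le_trans (g1 (A z)).
have sM : `|g (A (z - y))| <= 1.
  apply: le_trans (gM _) _; apply: le_trans (ler_wpM2l (ltW M0) zy) _.
  rewrite mulrA ler_pdivrMr ?mulr_gt0 // (_ : 1 * _ = M * r + (2 + M * r)); last by ring.
  by rewrite lerDl addr_ge0 // mulr_ge0 ?ltW.
rewrite -(lerD2r 1) natr1; apply: le_trans yA _; apply: le_trans gy _.
have -> : g (A y) = g (A z) - g (A (z - y)) by rewrite AB linearB subKr.
by apply: le_trans (ler_normB _ _) _; rewrite lerD2l.
Qed.

(** A common kernel of finitely many functionals is too large for a finite span. In the induction,
    [x2] is taken outside the span of [x1 :: s], so subtracting the multiple of [x1] that kills [p]
    keeps it outside [s]. *)
Lemma kernel_outside_span (l : seq (X * {scalar X})) (s : seq X) : infinite_dim X ->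
  exists x, (forall p, List.In p l -> p.2 x = 0) /\ ~ in_span s x.
Proof.
move=> Xinf; elim: l s => [|p l IH] s.
  by have [x sx] := infinite_dim_span s Xinf; exists x.
have [x1 [l1 s1]] := IH s; have [x2 [l2 s2]] := IH (x1 :: s).
have [p1|p1] := eqVneq (p.2 x1) 0.
  by exists x1; split=> // q /= [<-|/l1].
exists (x2 - (p.2 x2 / p.2 x1) *: x1); split.
  move=> q /= [<-|lq]; rewrite linearB scalarZ; first by rewrite divfK ?subrr.
  by rewrite (l1 q lq) (l2 q lq) mulr0 subrr.
by move=> s3; apply: s2; exists (p.2 x2 / p.2 x1).
Qed.

(** Each new vector is in the kernels of the earlier functionals and outside the span of the earlier
    vectors; the new functional kills those vectors. *)
Lemma biorthogonal_sequence : infinite_dim X ->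
  exists (x : nat -> X) (f : nat -> {scalar X}),
    (forall n, bounded_functional (f n)) /\ forall m n, f m (x n) = (m == n)%:R.
Proof.
move=> Xinf; have sepX := norming_separate normingX.
have /choice[next nextP] : forall l : seq (X * {scalar X}), exists p : X * {scalar X},
    [/\ bounded_functional p.2, p.2 p.1 = 1 &
        forall q, List.In q l -> p.2 q.1 = 0 /\ q.2 p.1 = 0].
  move=> l; have [x [lx xl]] := kernel_outside_span l [seq q.1 | q <- l] Xinf.
  have [f bf [fl fx]] := separate_span sepX xl.
  exists (x, f); split=> // q ql; split; last exact: lx.
  apply: fl; elim: l ql {lx xl} => //= q' l IH [->|/IH]; rewrite in_cons ?eqxx // => ->.
  by rewrite orbT.
pose L := fix L n := if n is m.+1 then next (L m) :: L m else [::].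
pose p n := next (L n).
have Lp m n : (m < n)%N -> List.In (p m) (L n).
  elim: n => //= n IH; rewrite ltnS leq_eqVlt => /predU1P[->|/IH]; first by left.
  by right.
exists (fun n => (p n).1), (fun n => (p n).2); split=> [n|m n].
  by have [] := nextP (L n).
have [mn|nm|->] := ltngtP m n.
- by have [_ _ /(_ _ (Lp _ _ mn))[]] := nextP (L n).
- by have [_ _ /(_ _ (Lp _ _ nm))[]] := nextP (L m).
- by have [] := nextP (L n).
Qed.

(* Kakutani-Mackey: if [h] were unbounded near [0], a convergent series
   [sum c_n x_n] along a biorthogonal system with the [c_n] tiny but the [h c_n]
   huge would contradict [`|h (f_n x)| <= M_n * `|A x|]. *)
Lemma semilinear_locally_bounded (A : X -> X) (h : {rmorphism K -> K}) :
  infinite_dim X ->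
  (forall f : {scalar X}, bounded_functional f ->
     exists2 g : {scalar X}, bounded_functional g & forall x, g (A x) = h (f x)) ->
  exists e N, 0 < e /\ forall c, `|c| <= e -> `|h c| <= N.
Proof.
move=> Xinf fg; apply: contrapT => unb.
have big e N : 0 < e -> 0 <= N -> exists c, `|c| <= e /\ N < `|h c|.
  move=> e0 N0; apply: contrapT => /forallNP H; apply: unb; exists e, N; split=> // c ce.
  by rewrite real_leNgt ?normr_real ?ger0_real //; apply/negP => Nc; apply: (H c).
have [x [f [bf fx]]] := biorthogonal_sequence Xinf.
have /choice[M MP] : forall n, exists M, 0 < M /\ forall z, `|h (f n z)| <= M * `|A z|.
  move=> n; have [g bg gE] := fg (f n) (bf n); have [M M0 gM] := bound_gt0 bg.
  by exists M; split=> // z; rewrite -gE.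
have x0 n : 0 < `|x n|.
  rewrite normr_gt0; apply: contraTneq (oner_neq0 K) => xn0.
  by have := fx n n; rewrite xn0 linear0 eqxx => /esym/eqP; rewrite oner_eq0.
have /choice[c cP] : forall n, exists c, `|c| <= 2^-1 ^+ n / `|x n| /\ n%:R * M n < `|h c|.
  move=> n; apply: big; first by rewrite divr_gt0 // exprn_gt0 // invr_gt0.
  by rewrite mulr_ge0 // ltW //; have [] := MP n.
pose u n := \sum_(k < n) c k *: x k.
have ud n : `|u n.+1 - u n| <= 2 * 2^-1 ^+ n - 2 * 2^-1 ^+ n.+1.
  rewrite /u big_ord_recr /= addrAC subrr add0r normrZ -ler_pdivlMr //.
  have -> : 2 * 2^-1 ^+ n - 2 * 2^-1 ^+ n.+1 = 2^-1 ^+ n :> K.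
    by rewrite exprS mulrA mulfV ?pnatr_eq0 // mul1r mulr_natl mulr2n addrK.
  by have [] := cP n.
have [|z zlim] := telescoping_limit archiK ud.
  by move=> n; rewrite mulr_ge0 ?exprn_ge0 ?invr_ge0 ?ler0n /=.
(* Partial sums with more than [n] terms have value [c n] under [f n], and boundedness of [f n]
   passes this to the limit. *)
have fz n : f n z = c n.
  apply/eqP; rewrite -subr_eq0; apply: contraT; rewrite -normr_gt0 => e0.
  have [C C0 fC] := bound_gt0 (bf n).
  have [N /(_ (N + n.+1)%N (leq_addr _ _))] := zlim _ (divr_gt0 e0 C0).
  rewrite ltr_pdivlMr // mulrC => /(le_lt_trans (fC _)).
  rewrite linearB; have -> : f n (u (N + n.+1)%N) = c n; last by rewrite ltxx.
  rewrite linear_sum (bigD1 (Ordinal (leq_addl N n.+1))) //= scalarZ fx eqxx mulr1.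
  rewrite big1 ?addr0 // => k; rewrite scalarZ fx -val_eqE /= eq_sym => /negbTE ->.
  by rewrite mulr0.
have [n] := archiK `|A z|; rewrite normr_id.
have [Mn0 /(_ z)] := MP n; rewrite fz => H; have [_ /lt_le_trans/(_ H)] := cP n.
by rewrite mulrC ltr_pM2l // => /lt_trans H1 /H1; rewrite ltxx.
Qed.
End Boundedness.

(** * Automorphisms of the scalars *)

Section Scalars.
Variable R : realType.

Lemma norm_archimedean_real : norm_archimedean R.
Proof. by move=> x; exists (Num.Def.archi_bound `|x|); exact: archi_boundP. Qed.

Lemma norm_archimedean_complex : norm_archimedean R[i].
Proof.
move=> x; rewrite normc_def; set r := Num.sqrt _.
have [n rn] := norm_archimedean_real r; exists n.
rewrite -(rmorph_nat (real_complex R)) ltcR; apply: le_lt_trans rn; exact: ler_norm.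
Qed.

(** Nonnegative reals are squares, so [h] is monotone; it fixes the rationals, which are dense. *)
Lemma real_rmorphism_id (h : {rmorphism R -> R}) x : h x = x.
Proof.
have h_ge0 y : 0 <= y -> 0 <= h y.
  by move=> y0; rewrite -(sqr_sqrtr y0) rmorphXn sqr_ge0.
have hle y z : y <= z -> h y <= h z.
  by rewrite -subr_ge0 => /h_ge0; rewrite rmorphB subr_ge0.
apply/eqP; rewrite eq_le; apply/andP; split; rewrite leNgt; apply/negP => /rat_in_itvoo[q];
  rewrite in_itv /= => /andP[q1 q2].
  by have := hle _ _ (ltW q1); rewrite fmorph_rat leNgt q2.
by have := hle _ _ (ltW q2); rewrite fmorph_rat leNgt q1.
Qed.

(** For real [r] and a rational [q] near [r], the number [c = n * (r - q)] is small and
    [h c - c = n * (h r - r)]. Boundedness for all [n] forces [h r = r], and [h 'i] is a square root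
    of [-1]. *)
Lemma locally_bounded_complex_rmorphism (h : {rmorphism R[i] -> R[i]}) (e N : R[i]) :
  0 < e -> (forall c, `|c| <= e -> `|h c| <= N) ->
  (forall z, h z = z) \/ (forall z, h z = z^*).
Proof.
move=> e0 hN.
have e0' : 0 < complex.Re e by move: e0; rewrite ltcE => /andP[].
have eE : e = (complex.Re e)%:C.
  by apply/eqP; rewrite eq_complex /= eqxx /=; move: e0; rewrite ltcE => /andP[].
have hr (r : R) : h r%:C = r%:C.
  apply/eqP; rewrite -subr_eq0; apply: contraT => d0.
  have [n] := norm_archimedean_complex ((N + e) / (h r%:C - r%:C)).
  rewrite normrM normfV ltr_pdivrMr ?normr_gt0 // -{1}[n%:R]normr_nat -normrM.
  (* Dividing by [n.+1] avoids a zero denominator and still gives a bound [e] after multiplication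
     by [n]. *)
  have r0 : 0 < complex.Re e / n.+1%:R by rewrite divr_gt0.
  have [|q] := @rat_in_itvoo R (r - complex.Re e / n.+1%:R) (r + complex.Re e / n.+1%:R).
    by rewrite ltrD2l gtrN.
  rewrite in_itv /= -ltr_distl => rq.
  pose c := (n%:R * (r - ratr q))%:C.
  have ce : `|c| <= e.
    rewrite eE normc_def /= expr0n addr0 sqrtr_sqr lecR normrM normr_nat.
    have nn : n%:R <= n.+1%:R :> R by rewrite ler_nat.
    apply: le_trans (ler_wpM2r (normr_ge0 _) nn) _.
    by rewrite mulrC -ler_pdivlMr // distrC ltW.
  have -> : n%:R * (h r%:C - r%:C) = h c - c.
    rewrite /c rmorphM rmorphB /= rmorphM rmorphB /= !rmorph_nat !fmorph_rat; ring.
  have H : `|h c - c| <= N + e by apply: le_trans (ler_normB _ _) (lerD (hN c ce) ce).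
  by rewrite (ger0_norm (le_trans (normr_ge0 _) H)) => /lt_geF; rewrite H.
have ii : h 'i ^+ 2 = -1 by rewrite -rmorphXn sqr_i rmorphN1.
have hE z : h z = (complex.Re z)%:C + h 'i * (complex.Im z)%:C.
  by rewrite {1}(complexE z) rmorphD rmorphM !hr.
have /eqP : (h 'i - 'i) * (h 'i + 'i) = 0 by rewrite -subr_sqr ii sqr_i subrr.
rewrite mulf_eq0 subr_eq0 addr_eq0 => /orP[] /eqP hi; [left|right] => z; rewrite hE hi.
  by rewrite -complexE.
by apply/eqP; rewrite eq_complex; case: z => a b /=; apply/andP; split; apply/eqP; ring.
Qed.
End Scalars.

(** * Boundedness of the implementing map and its inverse *)

Section Bounded.
Variables (K : numFieldType) (X : completeNormedModType K).
Hypothesis archiK : norm_archimedean K.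
Hypothesis normingX : norming X.

(** As [h] preserves absolute values, a bounded functional composed with [A] or with its inverse
    stays bounded, so uniform boundedness applies to both maps. *)
Lemma isometric_semilinear_bounded (phi : rank_one_idempotent X -> rank_one_idempotent X)
    (A : X -> X) (h : {rmorphism K -> K}) :
  bijective phi -> bijective A -> bijective h -> {morph A : x y / x + y} ->
  (forall t x, A (t *: x) = h t *: A x) ->
  (forall P x, \val (phi P) (A x) = A (\val P x)) ->
  (forall t, `|h t| = `|t|) ->
  exists B, [/\ cancel A B, cancel B A, exists M, forall x, `|A x| <= M * `|x|,
    exists M, forall x, `|B x| <= M * `|x| & forall P, \val (phi P) = A \o \val P \o B].
Proof.
move=> phib Ab hb AD AZ phiA hn.
have [B AK BK] := Ab; have [h' hK h'K] := hb.
have BD : {morph B : x y / x + y}.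
  by move=> x y; apply: (can_inj AK); rewrite AD !BK.
have BZ t x : B (t *: x) = h' t *: B x.
  by apply: (can_inj AK); rewrite AZ !BK h'K.
have hn' t : `|h' t| = `|t| by rewrite -hn h'K.
exists B; split=> //.
- apply: (pointwise_bounded_map archiK normingX AD AZ hn) => g bg.
  have [f [M fM] fE] := semilinear_functional_inv phib Ab hb AD AZ phiA bg.
  by exists M => x; rewrite fE hn.
- apply: (pointwise_bounded_map archiK normingX BD BZ hn') => f bf.
  have [g [M gM] gE] := semilinear_functional Ab AD AZ phiA bf.
  by exists M => x; rewrite -[f (B x)]hK -gE BK hn'.
- by move=> P; apply/funext => x /=; rewrite -phiA BK.
Qed.
End Bounded.

(** * Matrices of semilinear maps *)

Section Matrices.
Variables (K : fieldType) (V : lmodType K) (n : nat) (e : 'I_n -> V).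
Hypothesis eV : lin_basis [set: V] e.

Lemma coords_uniq (c : 'I_n -> K) x : x = \sum_i c i *: e i -> forall i, coords e x i 0 = c i.
Proof.
move=> xc i; apply/eqP; rewrite -subr_eq0; apply/eqP.
apply: (eV.1 (fun i => coords e x i 0 - c i)).
under eq_bigr do rewrite scalerBl.
by rewrite sumrB coordsE // -xc subrr.
Qed.

Lemma coords_semilinear (A : V -> V) (h : {rmorphism K -> K}) x :
  {morph A : x y / x + y} -> (forall t x, A (t *: x) = h t *: A x) ->
  coords e (A x) = op_mx e A *m map_mx h (coords e x).
Proof.
move=> AD AZ; have A0 : A 0 = 0 by apply: (addrI (A 0)); rewrite -AD !addr0.
apply/colP => i; apply: (coords_uniq (c := fun i => (op_mx e A *m map_mx h (coords e x)) i 0)).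
rewrite -{1}(coordsE x eV) (big_morph A AD A0).
under eq_bigr => j _ do rewrite AZ -(coordsE (A (e j)) eV) scaler_sumr.
rewrite exchange_big; apply: eq_bigr => k _.
rewrite mxE scaler_suml; apply: eq_bigr => j _.
by rewrite scalerA !mxE mulrC.
Qed.

Lemma coords_basis j : coords e (e j) = delta_mx j 0.
Proof.
apply/colP => i; rewrite mxE eqxx andbT; apply: (coords_uniq (c := fun i => (i == j)%:R)).
rewrite (bigD1 j) //= eqxx scale1r big1 ?addr0 // => k /negbTE ->.
by rewrite scale0r.
Qed.

Lemma col_op_mx (T : V -> V) j : col j (op_mx e T) = coords e (T (e j)).
Proof. by apply/colP => i; rewrite !mxE. Qed.

(** The relation [Q A = A P], read on basis vectors, equates the columns of the two matrix products;
    the entrywise image under [h] of the matrix of [A^-1] inverts that of [A]. *)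
Lemma op_mx_semilinear_conj (A : V -> V) (h : {rmorphism K -> K}) :
  bijective A -> {morph A : x y / x + y} -> (forall t x, A (t *: x) = h t *: A x) ->
  op_mx e A \in unitmx /\ forall P Q : V -> V, linear Q -> (forall x, Q (A x) = A (P x)) ->
    op_mx e Q = op_mx e A *m map_mx h (op_mx e P) *m invmx (op_mx e A).
Proof.
move=> [B AK BK] AD AZ.
have colsP (M N : 'M[K]_n) : (forall j, col j M = col j N) -> M = N.
  by move=> MN; apply/matrixP => i j; have /colP/(_ i) := MN j; rewrite !mxE.
have colM (M N : 'M[K]_n) j : col j (M *m N) = M *m col j N by rewrite !colE mulmxA.
have Au : op_mx e A \in unitmx.
  suff /mulmx1_unit[] : op_mx e A *m map_mx h (op_mx e B) = 1%:M by [].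
  apply: colsP => j; rewrite colM -map_col col_op_mx.
  by rewrite -coords_semilinear // BK coords_basis col1.
split=> // P Q Ql QA; apply: (canRL (mulmxK Au)).
apply: colsP => j; rewrite !colM -map_col !col_op_mx -coords_semilinear //.
by rewrite -coords_op_mx // QA.
Qed.
End Matrices.

(** * The real case and the two complex cases *)

Theorem mainTheorem1 (R : realType) :
  (* X real *)
  (forall (X : completeNormedModType R)
      (phi : rank_one_idempotent X -> rank_one_idempotent X),
    dim_ge X 3 -> bijective phi -> preserves_zero_products phi ->
    exists A B : X -> X,
      bounded_inverse *:%R A B /\
      forall P, \val (phi P) = A \o \val P \o B)
  /\
  (* X complex *)
  (forall (X : completeNormedModType R[i])
      (phi : rank_one_idempotent X -> rank_one_idempotent X),
    dim_ge X 3 -> bijective phi -> preserves_zero_products phi ->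
    (infinite_dim X ->
      exists A B : X -> X,
        (bounded_inverse *:%R A B \/
         bounded_inverse ((@conjc R) \; *:%R) A B) /\
        forall P, \val (phi P) = A \o \val P \o B)
    /\
    (forall (n : nat) (e : 'I_n -> X), lin_basis [set: X] e ->
      exists (A : 'M[R[i]]_n) (h : {rmorphism R[i] -> R[i]}),
        [/\ A \in unitmx, bijective h &
            forall P, op_mx e (\val (phi P)) =
              A *m map_mx h (op_mx e (\val P)) *m invmx A])).
Proof.
split=> X phi X3 phib phi0.
  have nX := @norming_real R X.
  have [A [h [Ab hb AD AZ phiA]]] := idempotent_map_semilinear (norming_separate nX) X3 phib phi0.
  have hn t : `|h t| = `|t| by rewrite real_rmorphism_id.
  have [B [AK BK AM BM phiE]] := isometric_semilinear_bounded
    (@norm_archimedean_real R) nX phib Ab hb AD AZ phiA hn.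
  have Al : linear A by move=> c x y; rewrite AD AZ real_rmorphism_id.
  have Bl : linear B by move=> c x y; apply: (can_inj AK); rewrite Al !BK.
  by exists A, B.
have nX := @norming_complex R X.
have [A [h [Ab hb AD AZ phiA]]] := idempotent_map_semilinear (norming_separate nX) X3 phib phi0.
split=> [Xinf|n e eV].
  have [e [N [e0 hN]]] := semilinear_locally_bounded (@norm_archimedean_complex R) nX Xinf
    (semilinear_functional Ab AD AZ phiA).
  (* Infinite dimension enters here: [h] is the identity or the conjugation, hence isometric. *)
  have hE := locally_bounded_complex_rmorphism e0 hN.
  have hn t : `|h t| = `|t| by case: hE => ->; rewrite ?normcJ.
  have [B [AK BK AM BM phiE]] := isometric_semilinear_bounded
    (@norm_archimedean_complex R) nX phib Ab hb AD AZ phiA hn.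
  exists A, B; split=> //; case: hE => hE; [left|right].
    have Al : linear A by move=> c x y; rewrite AD AZ hE.
    have Bl : linear B by move=> c x y; apply: (can_inj AK); rewrite Al !BK.
    by [].
  have Al : linear_for ((@conjc R) \; *:%R) A by move=> c x y; rewrite AD AZ hE.
  have Bl : linear_for ((@conjc R) \; *:%R) B.
    by move=> c x y; apply: (can_inj AK); rewrite BK AD AZ hE /= conjcK !BK.
  by [].
have [Au AE] := op_mx_semilinear_conj eV Ab AD AZ.
exists (op_mx e A), h; split=> // P; apply: AE => //.
by have /set_mem[[]] := valP (phi P).
Qed.
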